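(* Let $X$ be a locally compact Hausdorff space, let $E$ be a monotone complete partially ordered vector space, and let $\pi\colon C_c(X)\to E$ be a positive operator. Suppose that $\mu\colon\mathscr B\to\overline{E^+}$ is a regular Borel measure such that $\pi(f)=\int_X^{o}f\,d\mu$ for $f\in C_c(X)$; $\mu(V)=\bigvee\{\pi(f):f\prec V\}$ in $E^+$ for every open subset $V$ of $X$ with finite measure; and $\mu(K)=\bigwedge\{\pi(f):K\prec f\}$ in $E^+$ for every compact subset $K$ of $X$. Suppose, furthermore, that $E$ has the countable sup property, and that $I_\mu\colon\mathcal L^1(X,\mathscr B,\mu;\mathbb R)\to E$ preserves moduli. Then: (1) $$I_\mu(\mathcal L^1(X,\mathscr B,\mu;\mathbb R^+))=I_\mu(\mathcal L^1(X,\mathscr B,\mu;\mathbb R^+))^{\Uparrow}=I_\mu(\mathcal L^1(X,\mathscr B,\mu;\mathbb R^+))^{\Downarrow}$$ and $$I_\mu(\mathcal L^1(X,\mathscr B,\mu;\mathbb R^+))=I_\mu\big([\![C_c(X)^+]\!]^{\uparrow\downarrow\uparrow}\big)=[\pi(C_c(X)^+)]^{\uparrow\downarrow\uparrow};$$ (2) If $\mu$ is inner regular at all Borel subsets of $X$ with finite measure, then $$I_\mu(\mathcal L^1(X,\mathscr B,\mu;\mathbb R^+))=I_\mu\big([\![C_c(X)^+]\!]^{\downarrow\uparrow}\big)=[\pi(C_c(X)^+)]^{\downarrow\uparrow};$$ (3) If $\mu$ is finite and $L^1(X,\mathscr B,\mu;\mathbb R)=\mathrm B(X,\mathscr B,\mu;\mathbb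 R)$, then $$I_\mu(\mathcal L^1(X,\mathscr B,\mu;\mathbb R^+))=I_\mu\big([\![C_c(X)^+]\!]^{\uparrow\downarrow}\big)=[\pi(C_c(X)^+)]^{\uparrow\downarrow}.$$
   Context: All vector spaces are over $\mathbb R$; $\mathbb R^+=[0,\infty)$. A partially ordered vector space $E$ has a proper (not necessarily generating) positive cone $E^+$ and is always supposed to be Archimedean. $x_\lambda\uparrow x$ (resp. $x_\lambda\downarrow x$) means that $(x_\lambda)$ is an increasing (resp. decreasing) net with supremum (resp. infimum) $x$. $E$ is monotone complete if every increasing net that is bounded above has a supremum. $E$ has the countable sup property if, for every net $(x_\lambda)\subseteq E^+$ and $x\in E^+$ with $x_\lambda\uparrow x$, there is a countable set of indices $\{\lambda_n\}$ with $x=\sup_n x_{\lambda_n}$. An operator $T\colon E\to F$ between partially ordered vector spaces preserves moduli if, whenever $|x|=x\vee(-x)$ exists in $E$, $|Tx|$ exists in $F$ and $T|x|=|Tx|$. $\overline E=E\cup\{\infty\}$ with $\infty$ as largest element, and $\overline{E^+}=E^+\cup\{\infty\}$ with the obvious addition and action of $\mathbb R^+$. $\mathscr B$ is the Borel $\sigma$-algebra of $X$ (generated by the open sets). A measure $\mu\colon\mathscr B\to\overline{E^+}$ is a map with $\mu(\emptyset)=0$ and $\mu(\bigcup_n\Delta_n)=\bigvee_{N}\sum_{n=1}^N\mu(\Delta_n)$ in $\overline E$ for pairwise disjoint sequences. It is finite if $\mu(X)\in E$; $\Delta$ has finite measure if $\mu(\Delta)\in E$. It is a Borel measure if compact sets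 have finite measure; inner regular at $\Delta$ if $\mu(\Delta)=\bigvee\{\mu(K):K\subseteq\Delta\text{ compact}\}$, and outer regular at $\Delta$ if $\mu(\Delta)=\bigwedge\{\mu(V):V\supseteq\Delta\text{ open}\}$, in $\overline E$; a regular Borel measure is a Borel measure that is inner regular at all open sets and outer regular at all Borel sets. Order integral: for $\varphi=\sum_{i=1}^n r_i\chi_{\Delta_i}$ with $r_i\in\mathbb R^+$ and disjoint measurable $\Delta_i$, $\int_X^{o}\varphi\,d\mu=\sum r_i\mu(\Delta_i)\in\overline{E^+}$; for measurable $f\colon X\to[0,\infty]$, $\int_X^{o}f\,d\mu=\bigvee_n\int_X^{o}\varphi_n\,d\mu$ for any sequence of such $\varphi_n\uparrow f$ pointwise (independent of the choice). $\mathcal L^1(X,\mathscr B,\mu;\mathbb R)$ consists of the measurable $f\colon X\to\mathbb R$ with $\int_X^{o}|f|\,d\mu\in E$, and then $I_\mu(f)=\int^{o}_X f\,d\mu=\int^{o}_Xf^+\,d\mu-\int^{o}_Xf^-\,d\mu$; $\mathcal L^1(X,\mathscr B,\mu;\mathbb R^+)$ is its positive cone. $L^1(X,\mathscr B,\mu;\mathbb R)$ is its quotient by the functions vanishing $\mu$-almost everywhere; the induced map on it is also denoted by $I_\mu$. $\mathrm B(X,\mathscr B,\mu;\mathbb R)$ is the space of bounded measurable functions modulo those vanishing $\mu$-a.e.; $L^1=\mathrm B$ means equality under the canonical identification. $[\![S]\!]$ denotes the image of $S$ in $L^1(X,\mathscr B,\mu;\mathbb R)$. $C_c(X)$ is the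 space of real-valued compactly supported continuous functions. For $S\subseteq X$: $f\prec S$ means $f\in C_c(X)$, $0\le f\le1$, $\operatorname{supp}f\subseteq S$; $S\prec f$ means $f\in C_c(X)$, $0\le f\le 1$, $f=1$ on $S$. For a non-empty subset $S$ of a partially ordered vector space $F$, $S^{\Uparrow}$ (resp. $S^{\uparrow}$) is the set of all $x\in F$ for which there is a net (resp. sequence) in $S$ with $x_\lambda\uparrow x$ in $F$; $S^{\Downarrow}$ and $S^{\downarrow}$ are defined similarly with decreasing nets, resp. sequences; $S^{\uparrow\downarrow}=(S^{\uparrow})^{\downarrow}$, etc. Ups and downs of subsets of $E$ are taken in $E$; those of $[\![C_c(X)^+]\!]$ are taken in $L^1(X,\mathscr B,\mu;\mathbb R)$. *)

(* Defs.v *)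
From HB Require Import structures.
From mathcomp Require Import all_boot all_order all_algebra generic_quotient.
From mathcomp Require Import all_classical all_reals all_analysis.

(* [R : realType] is the field of real numbers. *)

Set Implicit Arguments.
Unset Strict Implicit.
Unset Printing Implicit Defensive.

Import Order.TTheory GRing.Theory Num.Theory.
Import numFieldNormedType.Exports.

Local Open Scope classical_set_scope.
Local Open Scope ring_scope.

Section suprema_in_a_subset.
Context {d : Order.disp_t} {T : porderType d}.
Implicit Types (D S : set T).

(* Suprema and infima computed in the subset [D] of [T] with the induced order;
   for [D = setT] these are the library's [supremums] and [infimums]. *)
Definition supremums_in D S : set T :=
  (D `&` ubound S) `&` lbound (D `&` ubound S).

Definition infimums_in D S : set T :=
  (D `&` lbound S) `&` ubound (D `&` lbound S).

Definition directed (I : Type) (leI : I -> I -> Prop) :=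
  [/\ inhabited I, (forall i, leI i i),
      (forall i j k, leI i j -> leI j k -> leI i k) &
      (forall i j, exists k, leI i k /\ leI j k)].

Definition increasing_net (I : Type) (leI : I -> I -> Prop) (u : I -> T) :=
  directed leI /\ (forall i j, leI i j -> (u i <= u j)%O).

Definition decreasing_net (I : Type) (leI : I -> I -> Prop) (u : I -> T) :=
  directed leI /\ (forall i j, leI i j -> (u j <= u i)%O).

Definition net_up_in D S : set T :=
  [set x | exists (I : Type) (leI : I -> I -> Prop) (u : I -> T),
     [/\ increasing_net leI u, (forall i, S (u i)) &
         supremums_in D (range u) x]].

Definition net_down_in D S : set T :=
  [set x | exists (I : Type) (leI : I -> I -> Prop) (u : I -> T),
     [/\ decreasing_net leI u, (forall i, S (u i)) &
         infimums_in D (range u) x]].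

Definition seq_up_in D S : set T :=
  [set x | exists u : nat -> T,
     [/\ nondecreasing_seq u, (forall n, S (u n)) &
         supremums_in D (range u) x]].

Definition seq_down_in D S : set T :=
  [set x | exists u : nat -> T,
     [/\ nonincreasing_seq u, (forall n, S (u n)) &
         infimums_in D (range u) x]].

End suprema_in_a_subset.

Notation net_up := (net_up_in setT).
Notation net_down := (net_down_in setT).
Notation seq_up := (seq_up_in setT).
Notation seq_down := (seq_down_in setT).

HB.mixin Record isArchimedeanOrdered (R : realType) (E : Type)
    of Num.POrderedZmodule E & GRing.Lmodule R E := {
  povs_leD2r : forall z x y : E, x <= y -> x + z <= y + z ;
  povs_scale_ge0 : forall (a : R) (x : E), 0 <= a -> 0 <= x -> 0 <= a *: x ;
  povs_archimedean : forall x : E, 0 <= x ->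
    infimums (range (fun n : nat => (n.+1%:R^-1 : R) *: x)) 0
}.

#[short(type="povsType")]
HB.structure Definition POVS (R : realType) :=
  {E of isArchimedeanOrdered R E & Num.POrderedZmodule E & GRing.Lmodule R E}.

Section povs_properties.
Context {R : realType} (E : povsType R).

Definition poscone : set E := [set x | 0 <= x].

Definition monotone_complete : Prop :=
  forall (I : Type) (leI : I -> I -> Prop) (u : I -> E),
    increasing_net leI u -> ubound (range u) !=set0 ->
    supremums (range u) !=set0.

Definition countable_sup_property : Prop :=
  forall (I : Type) (leI : I -> I -> Prop) (u : I -> E) (x : E),
    increasing_net leI u -> (forall i, 0 <= u i) -> 0 <= x ->
    supremums (range u) x ->
    exists l : nat -> I, supremums (range (u \o l)) x.

(* [D] is a linear space of functions with its pointwise order, and the modulus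
   [|f| = f \/ (- f)] is the one of [D]. *)
Definition preserves_moduli_on (X : Type) (D : set (X -> R))
    (T : (X -> R) -> E) :=
  forall f m : X -> R, D f -> supremums_in D [set f; - f] m ->
    supremums [set T f; - T f] (T m).

End povs_properties.
Arguments poscone {R} E.

Inductive adjoin_infty (E : Type) := Fin of E | Infty.
Arguments Infty {E}.

Section adjoin_infty_choice.
Variable E : Type.
HB.instance Definition _ := gen_eqMixin (adjoin_infty E).
HB.instance Definition _ := gen_choiceMixin (adjoin_infty E).
End adjoin_infty_choice.

Section adjoin_infty_order.
Variable E : porderType ring_display.
Implicit Types x y z : adjoin_infty E.

Definition ele x y : bool :=
  match x, y with
  | _, Infty => true
  | Infty, Fin _ => false
  | Fin a, Fin b => a <= b
  end.

Fact ele_refl : reflexive ele. Proof. by case=> /=. Qed.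
Fact ele_anti : antisymmetric ele.
Proof. by move=> [a|] [b|] //= /le_anti ->. Qed.
Fact ele_trans : transitive ele.
Proof. by move=> [a|] [b|] [c|] //=; exact: le_trans. Qed.

HB.instance Definition _ := Order.Le_isPOrder.Build ring_display (adjoin_infty E)
  ele_refl ele_anti ele_trans.
End adjoin_infty_order.

Section adjoin_infty_nmod.
Variable E : zmodType.
Implicit Types x y z : adjoin_infty E.

Definition eadd x y : adjoin_infty E :=
  match x, y with
  | Fin a, Fin b => Fin (a + b)
  | _, _ => Infty
  end.

Fact eaddA : associative eadd.
Proof. by move=> [a|] [b|] [c|] //=; rewrite addrA. Qed.
Fact eaddC : commutative eadd.
Proof. by move=> [a|] [b|] //=; rewrite addrC. Qed.
Fact eadd0 : left_id (Fin 0) eadd.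
Proof. by move=> [a|] //=; rewrite add0r. Qed.

HB.instance Definition _ := GRing.isNmodule.Build (adjoin_infty E)
  eaddA eaddC eadd0.
End adjoin_infty_nmod.

Section adjoin_infty_ops.
Context {R : realType} {E : lmodType R}.

Definition efinite (x : adjoin_infty E) : Prop := exists a, x = Fin a.

Definition efine (x : adjoin_infty E) : E := if x is Fin a then a else 0.

(* meant for [0 <= r] only; [0 * infinity = 0] *)
Definition escale (r : R) (x : adjoin_infty E) : adjoin_infty E :=
  match x with
  | Fin a => Fin (r *: a)
  | Infty => if r == 0 then 0 else Infty
  end.
End adjoin_infty_ops.

(* The library's measurable types are pointed; the Borel sets are handled here
   as a family of sets, so that [X] may be empty. *)
Definition borel (X : topologicalType) : set (set X) := <<s @open X >>.
Arguments borel X : clear implicits.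

(* Only the values of a measure on Borel sets are meaningful. *)
Record borel_set_measure (R : realType) (E : povsType R)
    (X : topologicalType) := BorelSetMeasure {
  measure_fun :> set X -> adjoin_infty E ;
  measure_fun_ge0 : forall A, borel X A -> Fin 0 <= measure_fun A ;
  measure_fun0 : measure_fun set0 = Fin 0 ;
  measure_fun_sigma_additive : forall A : nat -> set X,
    (forall n, borel X (A n)) -> trivIset setT A ->
    supremums (range (fun N : nat => \sum_(n < N) measure_fun (A n)))
              (measure_fun (\bigcup_n A n))
}.

Section borel_measure.
Context {R : realType} {E : povsType R} {X : topologicalType}.
Variable mu : borel_set_measure E X.

Definition finite_measure : Prop := efinite (mu setT).

Definition is_borel_measure : Prop := forall K, compact K -> efinite (mu K).

Definition inner_regular_at (A : set X) : Prop :=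
  supremums [set mu K | K in [set K | compact K /\ K `<=` A]] (mu A).

Definition outer_regular_at (A : set X) : Prop :=
  infimums [set mu V | V in [set V | open V /\ A `<=` V]] (mu A).

Definition regular_borel_measure : Prop :=
  [/\ is_borel_measure,
      (forall V, open V -> inner_regular_at V) &
      (forall A, borel X A -> outer_regular_at A)].

(* Some Borel null set contains the exceptional points, which need not form a
   Borel set. *)
Definition oae (P : X -> Prop) : Prop :=
  exists N, [/\ borel X N, mu N = Fin 0 & ~` [set x | P x] `<=` N].

Lemma borelC A : borel X A -> borel X (~` A).
Proof. by rewrite -setTD; exact: sigma_algebraCD. Qed.

Lemma borelU A B : borel X A -> borel X B -> borel X (A `|` B).
Proof.
move=> mA mB; rewrite -bigcup2E; apply: sigma_algebra_bigcup.
by case=> [|[|n]] //=; exact: sigma_algebra0.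
Qed.

Lemma borelI A B : borel X A -> borel X B -> borel X (A `&` B).
Proof.
move=> mA mB; rewrite -[_ `&` _]setCK setCI; apply: borelC.
by apply: borelU; exact: borelC.
Qed.

Lemma measureU A B : borel X A -> borel X B -> A `&` B = set0 ->
  mu (A `|` B) = mu A + mu B.
Proof.
move=> mA mB AB0.
pose F (n : nat) := if n is 0%N then A else if n is 1%N then B else set0.
have mF n : borel X (F n) by case: n => [|[|n]] //=; exact: sigma_algebra0.
have tF : trivIset setT F.
  apply/trivIsetP => -[|[|i]] [|[|j]] _ _ //= _; rewrite ?set0I ?setI0 //.
  by rewrite setIC.
have FE : \bigcup_n F n = A `|` B.
  apply/seteqP; split=> x; first by case=> -[|[|n]] _ //=; [left|right].
  by case=> ?; [exists 0%N|exists 1%N].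
have sumF n : \sum_(i < n.+2) mu (F i) = mu A + mu B.
  by rewrite 2!big_ord_recl/= big1 ?addr0// => i _; rewrite measure_fun0.
have [ub lb] := measure_fun_sigma_additive mu mF tF.
rewrite FE in ub lb; apply/eqP; rewrite eq_le; apply/andP; split; last first.
  by apply: ub; exists 2%N => //; rewrite (sumF 0%N).
have leDl (a b : adjoin_infty E) : Fin 0 <= b -> a <= a + b.
  case: a b => [a|] [b|] //= b0; rewrite /Order.le/=.
  by have := povs_leD2r a _ _ b0; rewrite add0r addrC.
have A0 := measure_fun_ge0 mu mA; have B0 := measure_fun_ge0 mu mB.
apply: lb => _ [[|[|n]] _ <-]; last by rewrite sumF.
  by rewrite big_ord0; exact: le_trans (leDl _ _ B0).
by rewrite big_ord_recl big_ord0 addr0; exact: leDl.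
Qed.

Lemma null_setU A B : borel X A -> borel X B -> mu A = Fin 0 -> mu B = Fin 0 ->
  mu (A `|` B) = Fin 0.
Proof.
move=> mA mB A0 B0.
have mBA : borel X (B `\` A) by rewrite setDE; apply: borelI => //; exact: borelC.
have mBIA : borel X (B `&` A) by exact: borelI.
have D0 : mu (B `\` A) = Fin 0.
  have : mu B = mu (B `&` A) + mu (B `\` A).
    rewrite -measureU//; last by rewrite setDE setIACA setICr setI0.
    by rewrite setDE -setIUr setUCr setIT.
  have := measure_fun_ge0 mu mBA; have := measure_fun_ge0 mu mBIA.
  rewrite B0; case: (mu (B `&` A)) (mu (B `\` A)) => [a|] [b|] //= a0 b0 [ab].
  congr Fin; apply/eqP; rewrite eq_le (b0 : 0 <= b) andbT ab.
  by have := povs_leD2r b _ _ (a0 : 0 <= a); rewrite add0r.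
have -> : A `|` B = A `|` (B `\` A).
  apply/seteqP; split=> x; last by case=> [|[]]; [left|right].
  by case; [left|case: (pselect (A x)); [left|right]].
rewrite measureU// ?A0 ?D0; last by rewrite setDE setIC -setIA setICl setI0.
by congr Fin; rewrite addr0.
Qed.

End borel_measure.

Section order_integral.
Context {R : realType} {E : povsType R} {X : topologicalType}.
Variable mu : borel_set_measure E X.
Implicit Types (f g phi : X -> R).

Definition borel_measurable f : Prop :=
  forall B : set R, borel R B -> borel X (f @^-1` B).

Definition simple_nonneg phi : Prop :=
  [/\ borel_measurable phi, finite_set (range phi) & forall x, 0 <= phi x].

Definition simple_integral phi : adjoin_infty E :=
  \sum_(r \in range phi) escale r (mu (phi @^-1` [set r])).

(* Any two such sequences give the same supremum when [E] is monotone complete,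
   so that the choice made by [xget] is immaterial. *)
Definition order_integral (f : X -> \bar R) : adjoin_infty E :=
  xget Infty [set y | exists phi : nat -> X -> R,
    [/\ (forall n, simple_nonneg (phi n)),
        (forall x, nondecreasing_seq (fun n => phi n x)),
        (forall x, (fun n => (phi n x)%:E) @ \oo --> f x) &
        supremums (range (fun n => simple_integral (phi n))) y]].

Definition ointegrable : set (X -> R) :=
  [set f | borel_measurable f /\
           efinite (order_integral (fun x => `|f x|%:E))].

Definition ointegrable_nonneg : set (X -> R) :=
  [set f | ointegrable f /\ forall x, 0 <= f x].

(* Meaningful for [f] in [ointegrable], where both integrals are finite. *)
Definition Imu f : E :=
  efine (order_integral (EFin \o f^\+)) - efine (order_integral (EFin \o f^\-)).

End order_integral.

Record bmfun (R : realType) (X : topologicalType) := Bmfun {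
  bmfun_fun :> X -> R ;
  _ : `[< borel_measurable bmfun_fun >]
}.
Arguments bmfun R X : clear implicits.

HB.instance Definition _ (R : realType) (X : topologicalType) :=
  [isSub of bmfun R X for @bmfun_fun R X].
HB.instance Definition _ (R : realType) (X : topologicalType) :=
  [Choice of bmfun R X by <:].

Section classes.
Context {R : realType} {E : povsType R} {X : topologicalType}.
Variable mu : borel_set_measure E X.

Definition aeq (f g : bmfun R X) : bool := `[< oae mu (fun x => f x = g x) >].

Lemma aeI (P Q S : X -> Prop) : (forall x, P x -> Q x -> S x) ->
  oae mu P -> oae mu Q -> oae mu S.
Proof.
move=> PQS [M [mM M0 PM]] [N [mN N0 QN]]; exists (M `|` N).
split; [exact: borelU|exact: null_setU|].
move=> x /= nS; have [Px|nP] := pselect (P x); last by left; exact: PM.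
by right; apply: QN => Qx; exact/nS/PQS.
Qed.

Lemma aeT (P : X -> Prop) : (forall x, P x) -> oae mu P.
Proof.
move=> PT; exists set0; split; [exact: sigma_algebra0|exact: measure_fun0|].
by move=> x /(_ (PT x)).
Qed.

Let aeq_refl : reflexive aeq.
Proof. by move=> f; apply/asboolP/aeT. Qed.

Let aeq_sym : symmetric aeq.
Proof.
have W f g : aeq f g -> aeq g f.
  by move=> /asboolP fg; apply/asboolP; apply: (aeI _ fg fg) => x ->.
by move=> f g; apply/idP/idP; exact: W.
Qed.

Let aeq_trans : transitive aeq.
Proof.
move=> g f h /asboolP fg /asboolP gh; apply/asboolP; apply: (aeI _ fg gh).
by move=> x -> ->.
Qed.

Canonical aeq_equiv := EquivRel aeq aeq_refl aeq_sym aeq_trans.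

Local Open Scope quotient_scope.

Definition L0 : Type := {eq_quot aeq}.
HB.instance Definition _ := Choice.on L0.
HB.instance Definition _ := EqQuotient.on L0.

Definition L0_le (p q : L0) : bool :=
  `[< oae mu (fun x => repr p x <= repr q x) >].

Let L0_le_refl : reflexive L0_le.
Proof. by move=> p; apply/asboolP/aeT. Qed.

Let L0_le_anti : antisymmetric L0_le.
Proof.
move=> p q /andP[/asboolP pq /asboolP qp]; rewrite -[p]reprK -[q]reprK.
apply/eqmodP/asboolP; apply: (aeI _ pq qp) => x xpq xqp.
by apply/eqP; rewrite eq_le xpq xqp.
Qed.

Let L0_le_trans : transitive L0_le.
Proof.
move=> q p r /asboolP pq /asboolP qr; apply/asboolP; apply: (aeI _ pq qr).
by move=> x; exact: le_trans.
Qed.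

HB.instance Definition _ := Order.Le_isPOrder.Build ring_display L0
  L0_le_refl L0_le_anti L0_le_trans.

(* The image in [L0] of a set [S] of functions; only its measurable members
   count. *)
Definition aeclasses (S : set (X -> R)) : set L0 :=
  [set \pi_L0 f | f in [set f : bmfun R X | S f]].

(* [L1] and [Bdd] are the quotients of the integrable functions and of the
   bounded measurable functions, both embedded in [L0] in the canonical way. *)
Definition L1 : set L0 := aeclasses (ointegrable mu).

Definition Bdd : set L0 :=
  aeclasses [set f | exists M : R, forall x, `|f x| <= M].

(* Meaningful on [L1]; [Imu mu] is constant on its classes. *)
Definition IL1 (q : L0) : E := Imu mu (repr q).

End classes.
Arguments aeclasses {R E X} mu S.
Arguments L1 {R E X} mu.
Arguments Bdd {R E X} mu.
Arguments IL1 {R E X} mu q.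

Section Cc.
Context {R : realType} {X : topologicalType}.

Definition supp (f : X -> R) : set X := closure [set x | f x != 0].

Definition is_Cc (f : X -> R) : Prop := continuous f /\ compact (supp f).

Definition Cc_pred : {pred X -> R} := fun f => `[< is_Cc f >].

Record Cc_type := CcType { Cc_fun :> X -> R ; _ : Cc_fun \in Cc_pred }.

HB.instance Definition _ := [isSub of Cc_type for Cc_fun].
HB.instance Definition _ := [Choice of Cc_type by <:].

Lemma Cc_submod_closed : submod_closed Cc_pred.
Proof.
split.
  apply/asboolP; split; first by move=> x; exact: cvg_cst.
  suff -> : supp 0 = set0 by exact: compact0.
  rewrite /supp (_ : [set _ | _] = set0) ?closure0//.
  by apply/seteqP; split=> x //=; rewrite eqxx.
move=> a f g /asboolP[cf kf] /asboolP[cg kg]; apply/asboolP; split.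
  move=> x; apply: cvgD; last exact: cg.
  by apply: cvgM; [exact: cvg_cst|exact: cf].
apply: (@subclosed_compact _ _ (supp f `|` supp g)); first exact: closed_closure.
  exact: compactU.
rewrite /supp -closureU; apply: closure_subset => x /=; apply: contraPP.
move=> /not_orP[/negP + /negP]; rewrite !negbK => /eqP f0 /eqP g0.
apply/negP; rewrite negbK; apply/eqP.
by rewrite -[LHS]/(a * f x + g x) f0 g0 mulr0 addr0.
Qed.

HB.instance Definition _ :=
  GRing.isSubmodClosed.Build R (X -> R) Cc_pred Cc_submod_closed.
HB.instance Definition _ := [SubChoice_isSubLmodule of Cc_type by <:].

Definition Cc_nonneg : set Cc_type := [set f | forall x, 0 <= f x].

Definition prec_open (f : Cc_type) (S : set X) : Prop :=
  (forall x, 0 <= f x <= 1) /\ supp f `<=` S.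

Definition prec_compact (S : set X) (f : Cc_type) : Prop :=
  (forall x, 0 <= f x <= 1) /\ (forall x, S x -> f x = 1).

End Cc.
Arguments Cc_type R X : clear implicits.
Arguments Cc_nonneg R X : clear implicits.
Notation Cc := Cc_type.

Section representing.
Context {R : realType} {E : povsType R} {X : topologicalType}.

Definition positive_operator (pi : Cc R X -> E) : Prop :=
  forall f, Cc_nonneg R X f -> 0 <= pi f.

End representing.

(* Main.v *)
From HB Require Import structures.
Require Import Defs.
From mathcomp Require Import all_boot all_order all_algebra.
From mathcomp Require Import all_classical all_reals all_analysis.
From mathcomp Require Import measurable_realfun finmap ring lra.

(* Since the integral preserves moduli, it maps the supremum (infimum) of two
   integrable functions to the supremum (infimum) in [E] of their integrals.
   By the countable sup property a monotone net of integrals has a countable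
   subfamily with the same supremum (infimum); replacing its functions by finite
   suprema (infima) and applying the monotone convergence theorem shows that the
   integrals of the positive functions are closed under monotone limits.

   Conversely, regularity and the countable sup property write the indicator
   function of an open set of finite measure as an increasing limit of
   compactly supported functions, and that of a Borel set of finite measure as a
   decreasing limit of the former (or, under inner regularity, as an increasing
   limit of indicators of compact sets, which are decreasing limits of compactly
   supported functions).  These limits form cones closed under finite suprema
   and infima, hence contain the simple functions, and repeating the same kind
   of monotone limit adds nothing new.  All these approximations satisfy their
   inequalities everywhere, and converge in the sense that the integrals of the
   differences decrease to 0; as the integral is strictly positive on L1, they
   are monotone limits in L1 too. *)

Set Implicit Arguments.
Unset Strict Implicit.
Unset Printing Implicit Defensive.

Import Order.TTheory GRing.Theory Num.Theory.
Import numFieldNormedType.Exports.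

Local Open Scope classical_set_scope.
Local Open Scope ring_scope.

(** * Partially ordered vector spaces *)

(** [E] need not be a lattice, and functions whose integrals are ordered need not be ordered
    themselves. If the integrals of [f n] have supremum [v], the [f n] are replaced by their finite
    maxima, and it is preservation of moduli that keeps the integrals of these maxima below [v].
    Each identity has one closure in [L1] and one in [E]. Both contain the integrals of the iterated
    limits of functions, and both yield only integrals of positive functions, so one approximation
    result for functions settles the two together. Simple functions increase to their limit, which
    puts an increasing limit outermost. In (2) the indicators are already increasing limits, and the
    two increasing limits merge. In (3) a function bounded by a constant [c] is [c - g];
    approximating [g] from below approximates it from above, and this limit merges with the
    decreasing one that produces the indicators. *)

Section povs_theory.
Context {R : realType} {E : povsType R}.
Implicit Types (x y z : E) (S : set E).

Lemma povs_leD x y z t : x <= y -> z <= t -> x + z <= y + t.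
Proof.
move=> xy zt; apply: le_trans (povs_leD2r z _ _ xy) _.
by rewrite ![y + _]addrC; exact: povs_leD2r.
Qed.

Lemma povs_leD2rE z x y : (x + z <= y + z) = (x <= y).
Proof.
apply/idP/idP; last exact: povs_leD2r.
by move/(povs_leD2r (- z)); rewrite !addrK.
Qed.

Lemma povs_leD2lE z x y : (z + x <= z + y) = (x <= y).
Proof. by rewrite ![z + _]addrC povs_leD2rE. Qed.

Lemma povs_subr_ge0 x y : (0 <= y - x) = (x <= y).
Proof. by rewrite -(povs_leD2rE x 0) add0r subrK. Qed.

Lemma povs_leN x y : (- x <= - y) = (y <= x).
Proof. by rewrite -(povs_subr_ge0 (- x)) opprK addrC povs_subr_ge0. Qed.

Lemma povs_leBlDr x y z : (x - y <= z) = (x <= z + y).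
Proof. by rewrite -(povs_leD2rE y (x - y)) subrK. Qed.

Lemma povs_leBrDr x y z : (x <= z - y) = (x + y <= z).
Proof. by rewrite -(povs_leD2rE y x) subrK. Qed.

Lemma povs_addr_ge0 x y : 0 <= x -> 0 <= y -> 0 <= x + y.
Proof. by move=> x0 y0; have := povs_leD x0 y0; rewrite addr0. Qed.

Lemma povs_leZ (a : R) x y : 0 <= a -> x <= y -> a *: x <= a *: y.
Proof.
by move=> a0 xy; rewrite -povs_subr_ge0 -scalerBr povs_scale_ge0// povs_subr_ge0.
Qed.

Lemma povs_leZE (a : R) x y : 0 < a -> (a *: x <= a *: y) = (x <= y).
Proof.
move=> a0; apply/idP/idP; last by apply: povs_leZ; exact: ltW.
have ai : 0 <= a^-1 by rewrite invr_ge0 ltW.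
by move/(povs_leZ ai); rewrite !scalerA mulVf ?gt_eqF// !scale1r.
Qed.

(** The form in which the Archimedean axiom replaces arguments with an arbitrary epsilon. *)
Lemma povs_le_scale_inv (x y : E) : 0 <= x ->
  (forall n, y <= (n.+1%:R^-1 : R) *: x) -> y <= 0.
Proof. by move=> /povs_archimedean[_ lb] yx; apply: lb => _ [n _ <-]. Qed.

End povs_theory.

Section sups.
Context {d : Order.disp_t} {T : porderType d}.
Implicit Types (S : set T).

Lemma supremums_unique S x y : supremums S x -> supremums S y -> x = y.
Proof.
by move=> [ux lx] [uy ly]; apply/eqP; rewrite eq_le (lx _ uy) (ly _ ux).
Qed.

Lemma infimums_unique S x y : infimums S x -> infimums S y -> x = y.
Proof.
by move=> [ux lx] [uy ly]; apply/eqP; rewrite eq_le (lx _ uy) (ly _ ux).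
Qed.

Lemma supremums_rangeP (I : Type) (u : I -> T) x : supremums (range u) x <->
  (forall i, (u i <= x)%O) /\ (forall y, (forall i, u i <= y)%O -> (x <= y)%O).
Proof.
split=> -[ub lb]; split.
- by move=> i; apply: ub; exists i.
- by move=> y ys; apply: lb => _ [i _ <-].
- by move=> _ [i _ <-].
- by move=> y ys; apply: lb => i; apply: ys; exists i.
Qed.

Lemma infimums_rangeP (I : Type) (u : I -> T) x : infimums (range u) x <->
  (forall i, (x <= u i)%O) /\ (forall y, (forall i, y <= u i)%O -> (y <= x)%O).
Proof.
split=> -[ub lb]; split.
- by move=> i; apply: ub; exists i.
- by move=> y ys; apply: lb => _ [i _ <-].
- by move=> _ [i _ <-].
- by move=> y ys; apply: lb => i; apply: ys; exists i.
Qed.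

Lemma supremums_inT S : supremums_in setT S = supremums S.
Proof. by rewrite /supremums_in setTI. Qed.

Lemma infimums_inT S : infimums_in setT S = infimums S.
Proof. by rewrite /infimums_in setTI. Qed.

Lemma directed_nat : directed (fun m n : nat => (m <= n)%N : Prop).
Proof.
split=> //; [by constructor; exact: 0%N| |].
  by move=> i j k; exact: leq_trans.
by move=> i j; exists (maxn i j); rewrite leq_maxl leq_maxr.
Qed.

Lemma seq_up_in_sub D S S' : S `<=` S' -> seq_up_in D S `<=` seq_up_in D S'.
Proof. by move=> SS' x [u [mu Su ux]]; exists u; split=> // n; exact: SS'. Qed.

Lemma seq_down_in_sub D S S' : S `<=` S' -> seq_down_in D S `<=` seq_down_in D S'.
Proof. by move=> SS' x [u [mu Su ux]]; exists u; split=> // n; exact: SS'. Qed.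

Lemma seq_up_net_up D S : seq_up_in D S `<=` net_up_in D S.
Proof.
move=> x [u [mu Su ux]]; exists nat, (fun m n : nat => (m <= n)%N : Prop), u.
by split=> //; split; [exact: directed_nat|move=> i j; exact: mu].
Qed.

Lemma seq_down_net_down D S : seq_down_in D S `<=` net_down_in D S.
Proof.
move=> x [u [mu Su ux]]; exists nat, (fun m n : nat => (m <= n)%N : Prop), u.
by split=> //; split; [exact: directed_nat|move=> i j; exact: mu].
Qed.

End sups.

Section povs_sups.
Context {R : realType} {E : povsType R}.
Implicit Types (x y z : E) (S : set E).

Lemma infimums_range_sub (I : Type) (u : I -> E) x a :
  supremums (range u) x -> infimums (range (fun i => a - u i)) (a - x).
Proof.
move=> /supremums_rangeP[ub lb]; apply/infimums_rangeP; split=> [i|y yu].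
  by rewrite povs_leD2lE povs_leN.
by rewrite povs_leBrDr addrC -povs_leBrDr; apply: lb => i;
  rewrite povs_leBrDr addrC -povs_leBrDr.
Qed.

Lemma supremums_range_sub (I : Type) (u : I -> E) x a :
  infimums (range u) x -> supremums (range (fun i => a - u i)) (a - x).
Proof.
move=> /infimums_rangeP[ub lb]; apply/supremums_rangeP; split=> [i|y yu].
  by rewrite povs_leD2lE povs_leN.
by rewrite povs_leBlDr addrC -povs_leBlDr; apply: lb => i;
  rewrite povs_leBlDr addrC -povs_leBlDr.
Qed.

(** On the tail above a fixed index [i0] the net [u i0 - u j] is positive and increasing, so the
    countable sup property applies to it. By directedness the tail has the same infimum as the whole
    net. *)
Lemma countable_inf_property (I : Type) (leI : I -> I -> Prop) (u : I -> E) x :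
  countable_sup_property E -> decreasing_net leI u ->
  infimums (range u) x -> exists l : nat -> I, infimums (range (u \o l)) x.
Proof.
move=> csp [[[i0] lexx lexy dir] ndu] ux.
have [ub lb] := (infimums_rangeP _ _).1 ux.
pose J := {i : I | leI i0 i}.
pose leJ (i j : J) := leI (sval i) (sval j).
pose v (j : J) := u i0 - u (sval j).
have vx : supremums (range v) (u i0 - x).
  apply: (supremums_range_sub (u := fun j : J => u (sval j))).
  apply/infimums_rangeP; split=> [j|y yu]; first exact: ub.
  apply: lb => i; have [k [ik i0k]] := dir i i0.
  by apply: le_trans (ndu _ _ ik); exact: (yu (exist _ k i0k)).
have [|||l lx] := csp J leJ v (u i0 - x) _ _ _ vx.
- split; last by move=> i j ij; rewrite /v povs_leD2lE povs_leN ndu.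
  split; [by constructor; exists i0|by move=> i; exact: lexx| |].
    by move=> i j k; exact: lexy.
  move=> [i ii] [j ij]; have [k [ik jk]] := dir i j.
  by exists (exist _ k (lexy _ _ _ ii ik)).
- by move=> [i ii]; rewrite povs_subr_ge0 ndu.
- by rewrite povs_subr_ge0.
- exists (fun n => sval (l n)).
  have := infimums_range_sub (u i0) lx; rewrite subKr.
  by under eq_fun do rewrite /v /= subKr.
Qed.

(* The condition [0 <= u i] in the countable sup property is removed by passing
   to a tail of the net and translating. *)
Lemma countable_sup_propertyT (I : Type) (leI : I -> I -> Prop) (u : I -> E) x :
  countable_sup_property E -> increasing_net leI u ->
  supremums (range u) x -> exists l : nat -> I, supremums (range (u \o l)) x.
Proof.
move=> csp [dir ndu] ux.
have := infimums_range_sub 0 ux; rewrite sub0r => ux'.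
have nu : decreasing_net leI (fun i => 0 - u i).
  by split=> [|i j ij]; [exact: dir|rewrite !sub0r povs_leN ndu].
have [l lx] := countable_inf_property csp nu ux'.
exists l; have := supremums_range_sub 0 lx; rewrite sub0r opprK.
by under eq_fun do rewrite /= !sub0r opprK.
Qed.

End povs_sups.

(** * Arithmetic and suprema in [E] with infinity adjoined *)

Section adjoin_infty_theory.
Context {R : realType} {E : povsType R}.
Local Notation EE := (adjoin_infty E).
Implicit Types (x y z : EE).

Lemma Fin_le (a b : E) : (Fin a <= Fin b) = (a <= b). Proof. by []. Qed.

Lemma le_Infty x : x <= Infty. Proof. by case: x. Qed.

Lemma FinD (a b : E) : Fin (a + b) = Fin a + Fin b. Proof. by []. Qed.

Lemma addInfty x : x + Infty = Infty. Proof. by case: x. Qed.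

Lemma le_Fin x (a : E) : x <= Fin a -> exists2 b, x = Fin b & b <= a.
Proof. by case: x => // b; exists b. Qed.

Lemma eleD x y z t : x <= y -> z <= t -> x + z <= y + t.
Proof. by case: x y z t => [a|] [b|] [c|] [e|] //; exact: povs_leD. Qed.

Lemma eaddr_ge0 x y : Fin 0 <= x -> Fin 0 <= y -> Fin 0 <= x + y.
Proof. by move=> x0 y0; have := eleD x0 y0; rewrite addr0. Qed.

Lemma ele_addr x y : Fin 0 <= y -> x <= x + y.
Proof. by move=> y0; have := eleD (lexx x) y0; rewrite addr0. Qed.

Lemma ebar_sum_ge0 (I : Type) (r : seq I) (P : pred I) (F : I -> EE) :
  (forall i, P i -> Fin 0 <= F i) -> Fin 0 <= \sum_(i <- r | P i) F i.
Proof. by move=> F0; elim/big_ind : _ => //; exact: eaddr_ge0. Qed.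

Lemma ebar_sum_le (I : Type) (r : seq I) (P : pred I) (F G : I -> EE) :
  (forall i, P i -> F i <= G i) ->
  \sum_(i <- r | P i) F i <= \sum_(i <- r | P i) G i.
Proof. by move=> FG; elim/big_ind2 : _ => // *; exact: eleD. Qed.

Lemma escaleDr (r : R) x y : escale r (x + y) = escale r x + escale r y.
Proof.
case: x y => [a|] [b|] /=; rewrite /GRing.add/=; last first.
- by case: (eqVneq r 0) => // _; rewrite /GRing.add/= addr0.
- by case: (eqVneq r 0) => // ->; rewrite scale0r /= addr0.
- by case: (eqVneq r 0) => // ->; rewrite scale0r /= addr0.
- by rewrite scalerDr.
Qed.

Lemma escaleDl (r s : R) x : 0 <= r -> 0 <= s ->
  escale (r + s) x = escale r x + escale s x.
Proof.
case: x => [a|] /= r0 s0; first by rewrite scalerDl.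
rewrite paddr_eq0//; case: (eqVneq r 0) => /= [r00|rn0].
  by rewrite /GRing.add/=; case: (s == 0); rewrite //= addr0.
by case: (s == 0).
Qed.

Lemma escaleA (r s : R) x : escale r (escale s x) = escale (r * s) x.
Proof.
case: x => [a|] /=; first by rewrite scalerA.
rewrite mulf_eq0; case: (eqVneq s 0) => /= _; last by rewrite orbF.
by rewrite orbT scaler0.
Qed.

Lemma escale0 (r : R) : escale r (Fin (0 : E)) = Fin 0.
Proof. by rewrite /= scaler0. Qed.

Lemma escale0l x : escale (0 : R) x = Fin 0.
Proof. by case: x => [a|] /=; rewrite ?scale0r ?eqxx. Qed.

Lemma escale1 x : escale (1 : R) x = x.
Proof. by case: x => [a|] /=; rewrite ?scale1r ?oner_eq0. Qed.

Lemma escale_sum (r : R) (I : Type) (s : seq I) (P : pred I) (F : I -> EE) :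
  escale r (\sum_(i <- s | P i) F i) = \sum_(i <- s | P i) escale r (F i).
Proof. by apply: (big_morph _ (escaleDr r)); exact: escale0. Qed.

Lemma escale_ge0 (r : R) x : 0 <= r -> Fin 0 <= x -> Fin 0 <= escale r x.
Proof.
case: x => [a|] /= r0 x0; last by case: ifP.
by rewrite Fin_le in x0 *; exact: povs_scale_ge0.
Qed.

Lemma escale_le (r : R) x y : 0 <= r -> x <= y -> escale r x <= escale r y.
Proof.
case: x y => [a|] [b|] //= r0 ab; first exact: (povs_leZ r0 ab).
by case: eqP => // ->; rewrite scale0r.
Qed.

Lemma escale_leE (r : R) x y : 0 < r -> (escale r x <= escale r y) = (x <= y).
Proof.
move=> r0; apply/idP/idP; last by apply: escale_le; exact: ltW.
have ri : 0 <= r^-1 by rewrite invr_ge0 ltW.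
by move/(escale_le ri); rewrite !escaleA mulVf ?gt_eqF// !escale1.
Qed.

Lemma escale_le2 (r s : R) x : Fin 0 <= x -> 0 <= r -> r <= s -> escale r x <= escale s x.
Proof.
move=> x0 r0 rs; rewrite -(subrK r s) addrC escaleDl// ?subr_ge0//.
by apply: ele_addr; rewrite escale_ge0// subr_ge0.
Qed.

(** The index set has to be inhabited for [r = 0], where every term is [Fin 0], even if [x] is
    [Infty]. *)
Lemma supremums_escale (I : Type) (u : I -> EE) x (r : R) : inhabited I -> 0 <= r ->
  supremums (range u) x -> supremums (range (fun i => escale r (u i))) (escale r x).
Proof.
move=> [i0]; rewrite le_eqVlt => /predU1P[<- _|r0 /supremums_rangeP[ub lb]].
  apply/supremums_rangeP; split=> [i|y]; first by rewrite !escale0l.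
  by move/(_ i0); rewrite !escale0l.
apply/supremums_rangeP; split=> [i|y uy]; first by rewrite escale_leE.
rewrite -(escale1 y) -(mulfV (lt0r_neq0 r0)) -escaleA escale_leE//.
apply: lb => i; rewrite -(escale_leE _ _ r0) escaleA mulfV ?gt_eqF// escale1.
exact: uy.
Qed.

(** Only finite elements can be subtracted. If [z] is finite then so is [y], because some [a i + y]
    lies below [z], and [y] can be moved to the other side. *)
Lemma ele_add_sup (I : Type) (a : I -> EE) x y z : inhabited I ->
  supremums (range a) x -> (forall i, a i + y <= z) -> x + y <= z.
Proof.
move=> [i0] /supremums_rangeP[_ lb]; case: z => [z|]; last by rewrite le_Infty.
case: y => [y|] az; last by have := az i0; rewrite addInfty.
suff /le_Fin[x' -> x'z] : x <= Fin (z - y).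
  by rewrite -FinD Fin_le -povs_leBrDr.
apply: lb => i; have := az i; case: (a i) => [c|] //.
by rewrite -FinD !Fin_le povs_leBrDr.
Qed.

(** By monotonicity the term at [maxn m n] dominates [a m + b n] for independent [m] and [n], so the
    two suprema can be taken one after the other. *)
Lemma supremums_eadd (a b : nat -> EE) x y :
  nondecreasing_seq a -> nondecreasing_seq b ->
  supremums (range a) x -> supremums (range b) y ->
  supremums (range (fun n => a n + b n)) (x + y).
Proof.
move=> nda ndb xa yb.
have [ua la] := (supremums_rangeP _ _).1 xa.
have [ub lb] := (supremums_rangeP _ _).1 yb.
apply/supremums_rangeP; split=> [n|z zub]; first exact: eleD.
have N : inhabited nat by constructor; exact: 0%N.
apply: (ele_add_sup N xa) => m; rewrite addrC; apply: (ele_add_sup N yb) => n.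
apply: le_trans (zub (maxn m n)); rewrite addrC.
by apply: eleD; [apply: nda; exact: leq_maxl|apply: ndb; exact: leq_maxr].
Qed.

Lemma supremums_ebar_sum (I : Type) (s : seq I) (P : pred I) (a : I -> nat -> EE)
    (x : I -> EE) :
  (forall i, P i -> nondecreasing_seq (a i)) ->
  (forall i, P i -> supremums (range (a i)) (x i)) ->
  supremums (range (fun n => \sum_(i <- s | P i) a i n)) (\sum_(i <- s | P i) x i).
Proof.
move=> nda xa.
suff [] : nondecreasing_seq (fun n => \sum_(i <- s | P i) a i n) /\
  supremums (range (fun n => \sum_(i <- s | P i) a i n)) (\sum_(i <- s | P i) x i) by [].
elim: s => [|i s [ndIH IH]].
  split; first by move=> m n _; rewrite !big_nil.
  by apply/supremums_rangeP; split=> [n|y /(_ 0%N)]; rewrite !big_nil.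
have -> : (fun n => \sum_(j <- i :: s | P j) a j n) =
    (fun n => (if P i then a i n else 0) + \sum_(j <- s | P j) a j n).
  by apply/funext => n; rewrite big_cons; case: ifP => //; rewrite add0r.
rewrite big_cons; case: ifPn => Pi.
  split; last by apply: supremums_eadd => //; [exact: nda|exact: xa].
  by move=> m n mn; apply: eleD; [exact: nda|exact: ndIH].
under eq_fun do rewrite add0r.
by split=> //; move=> m n mn; rewrite ndIH.
Qed.

(** An increasing sequence without a finite upper bound has supremum [Infty]; otherwise all its
    terms are finite and monotone completeness of [E] applies. *)
Lemma monotone_complete_ebar (u : nat -> EE) : monotone_complete E ->
  nondecreasing_seq u -> (forall n, Fin 0 <= u n) -> exists x, supremums (range u) x.
Proof.
move=> mc ndu u0.
have [[b ub]|nub] := pselect (exists b, forall n, u n <= Fin b); last first.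
  exists Infty; apply/supremums_rangeP; split=> [n|[y|] yu]; rewrite ?le_Infty//.
  by exfalso; apply: nub; exists y.
have ufin n : u n = Fin (efine (u n)) by have [c -> _] := le_Fin (ub n).
have [||x /supremums_rangeP[xu lx]] := mc _ (fun m n : nat => (m <= n)%N : Prop) (efine \o u).
- split; first exact: directed_nat.
  by move=> i j ij; rewrite -Fin_le -!ufin ndu.
- by exists b => _ [n _ <-]; rewrite -Fin_le -ufin.
exists (Fin x); apply/supremums_rangeP; split=> [n|[y|] yu]; rewrite ?le_Infty//.
  by rewrite ufin Fin_le xu.
by rewrite Fin_le; apply: lx => n; rewrite -Fin_le -ufin.
Qed.

Lemma supremums_Fin (I : Type) (u : I -> E) (x : E) : inhabited I ->
  supremums (range (fun i => Fin (u i))) (Fin x) <-> supremums (range u) x.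
Proof.
move=> [i0]; split=> /supremums_rangeP[xu lx]; apply/supremums_rangeP; split.
- by move=> i; rewrite -Fin_le; exact: xu.
- by move=> y yu; rewrite -Fin_le; apply: lx.
- by move=> i; rewrite Fin_le.
- by move=> [y|] yu; rewrite ?le_Infty// Fin_le; apply: lx => i; exact: (yu i).
Qed.

End adjoin_infty_theory.

(** * Borel measurability *)

(* The library's measurable types are pointed, so that its results apply to a
   space once one of its points has been chosen. *)
Definition pointed_copy (X : topologicalType) (x0 : X) : Type := X.

Section pointed_copy_instances.
Variables (X : topologicalType) (x0 : X).
HB.instance Definition _ := Choice.on (pointed_copy x0).
HB.instance Definition _ := isPointed.Build (pointed_copy x0) x0.
End pointed_copy_instances.

Definition borelType (X : topologicalType) (x0 : X) :=
  g_sigma_algebraType (@open X : set (set (pointed_copy x0))).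

HB.instance Definition _ (X : topologicalType) (x0 : X) :=
  Measurable.on (borelType x0).

Section borel_measurability.
Import HBNNSimple.
Context {R : realType} {X : topologicalType}.
Implicit Types (f g : X -> R) (A B : set X).

Lemma borel_realE (B : set R) : borel R B <-> measurable B.
Proof.
split; last first.
  have -> : measurable B = (@RGenOpens.G R).-sigma.-measurable B.
    by rewrite -RGenOpens.measurableE.
  apply: smallest_sub; first exact: smallest_sigma_algebra.
  by move=> _ [a [b ->]]; apply: sub_sigma_algebra; exact: interval_open.
apply: smallest_sub; last exact: open_measurable.
by split=> [|A|F]; [exact: measurable0|rewrite setTD; exact: measurableC|
  exact: bigcupT_measurable].
Qed.

Lemma borel_measurableP (x0 : X) f :
  borel_measurable f <-> measurable_fun setT (f : borelType x0 -> R).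
Proof.
split=> [mf _ B /borel_realE mB|mf B /borel_realE mB].
  by rewrite setTI; exact: mf.
by have := mf measurableT B mB; rewrite setTI.
Qed.

Lemma borel_set0 : borel X set0. Proof. exact: sigma_algebra0. Qed.

Lemma borelT : borel X setT.
Proof. by rewrite -setC0; apply: borelC; exact: borel_set0. Qed.

Lemma borelD A B : borel X A -> borel X B -> borel X (A `\` B).
Proof. by move=> mA mB; rewrite setDE; apply: borelI => //; exact: borelC. Qed.

Lemma borel_bigcup (F : nat -> set X) :
  (forall n, borel X (F n)) -> borel X (\bigcup_n F n).
Proof. exact: sigma_algebra_bigcup. Qed.

Lemma borel_open A : open A -> borel X A.
Proof. exact: sub_sigma_algebra. Qed.

Lemma borel_closed A : closed A -> borel X A.
Proof.
by move=> cA; rewrite -(setCK A); apply: borelC; apply: borel_open; rewrite openC.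
Qed.

(* On the empty space every set is Borel, and otherwise the library applies. *)
Lemma borel_measurable_ind f :
  (forall x0 : X, measurable_fun setT (f : borelType x0 -> R)) ->
  borel_measurable f.
Proof.
move=> mf; have [[x0]|nX] := pselect (inhabited X).
  exact/(borel_measurableP x0).
move=> B mB; rewrite (_ : _ @^-1` _ = set0); first exact: borel_set0.
by rewrite -subset0 => x; case: nX; constructor.
Qed.

Lemma borel_measurable_cst (c : R) : borel_measurable (fun _ : X => c).
Proof. by apply: borel_measurable_ind => x0; exact: measurable_cst. Qed.

Lemma borel_measurableD f g : borel_measurable f -> borel_measurable g ->
  borel_measurable (fun x => f x + g x).
Proof.
move=> mf mg; apply: borel_measurable_ind => x0.
by apply: measurable_funD; exact/borel_measurableP.
Qed.

Lemma borel_measurableB f g : borel_measurable f -> borel_measurable g ->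
  borel_measurable (fun x => f x - g x).
Proof.
move=> mf mg; apply: borel_measurable_ind => x0.
by apply: measurable_funB; exact/borel_measurableP.
Qed.

Lemma borel_measurableM f g : borel_measurable f -> borel_measurable g ->
  borel_measurable (fun x => f x * g x).
Proof.
move=> mf mg; apply: borel_measurable_ind => x0.
by apply: measurable_funM; exact/borel_measurableP.
Qed.

Lemma borel_measurable_max f g : borel_measurable f -> borel_measurable g ->
  borel_measurable (fun x => Num.max (f x) (g x)).
Proof.
move=> mf mg; apply: borel_measurable_ind => x0.
by apply: measurable_maxr; exact/borel_measurableP.
Qed.

Lemma borel_measurable_min f g : borel_measurable f -> borel_measurable g ->
  borel_measurable (fun x => Num.min (f x) (g x)).
Proof.
move=> mf mg; apply: borel_measurable_ind => x0.
by apply: measurable_minr; exact/borel_measurableP.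
Qed.

Lemma borel_measurable_norm f : borel_measurable f ->
  borel_measurable (fun x => `|f x|).
Proof.
move=> mf; apply: borel_measurable_ind => x0.
by apply: measurableT_comp => //; exact/borel_measurableP.
Qed.

Lemma borel_measurable_indic A : borel X A -> borel_measurable (\1_A : X -> R).
Proof.
by move=> mA; apply: borel_measurable_ind => x0; exact: measurable_indic.
Qed.

Lemma borel_measurable_cvg (h : nat -> X -> R) f :
  (forall n, borel_measurable (h n)) -> (forall x, h ^~ x @ \oo --> f x) ->
  borel_measurable f.
Proof.
move=> mh hf; apply: borel_measurable_ind => x0.
apply: (measurable_fun_cvg (h := (h : nat -> borelType x0 -> R))) => [m|x _].
  exact/borel_measurableP.
exact: hf.
Qed.

Lemma borel_le f g : borel_measurable f -> borel_measurable g ->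
  borel X [set x | f x <= g x].
Proof.
move=> mf mg; rewrite (_ : [set _ | _] = (fun x => g x - f x) @^-1` [set r | 0 <= r]).
  apply: borel_measurableB => //; apply/borel_realE.
  have -> : [set r : R | 0 <= r] = `[0, +oo[%classic by rewrite set_itvE.
  exact: measurable_itv.
by apply/seteqP; split=> x /=; rewrite subr_ge0.
Qed.

Lemma borel_measurable_approx f : borel_measurable f -> (forall x, 0 <= f x) ->
  exists phi : nat -> X -> R,
    [/\ (forall n, simple_nonneg (phi n)),
        (forall x, nondecreasing_seq (fun n => phi n x)) &
        (forall x, (fun n => phi n x) @ \oo --> f x)].
Proof.
move=> mf f0; have [[x0]|nX] := pselect (inhabited X); last first.
  exists (fun _ _ => 0); split=> [n|x|x]; try by case: nX; constructor.
  split; first exact: borel_measurable_cst.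
    rewrite (_ : range _ = set0)//.
    by rewrite -subset0 => _ [x _ <-]; case: nX; constructor.
  by move=> x; case: nX; constructor.
have mf' : measurable_fun setT (EFin \o (f : borelType x0 -> R)).
  exact/measurable_EFinP/borel_measurableP.
pose phi := nnsfun_approx measurableT mf'.
exists (fun n (x : X) => phi n (x : borelType x0)); split.
- move=> n; split; last by move=> x; exact: fun_ge0.
    by apply/(borel_measurableP x0).
  by have := @fimfunP (borelType x0) R (phi n); exact.
- by move=> x m n mn; have /lefP := nd_nnsfun_approx measurableT mf' mn; exact.
- move=> x; have f0' (y : borelType x0) : setT y -> (0 <= (EFin \o f) y)%E.
    by rewrite lee_fin.
  by have /fine_cvgP[] := cvg_nnsfun_approx measurableT mf' f0' (I : setT x).
Qed.

End borel_measurability.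

Section monotone_limits.
Context {R : realType}.
Implicit Types (u : nat -> R).

Lemma nondecreasing_cvgP u l : nondecreasing_seq u ->
  u @ \oo --> l <->
  (forall n, u n <= l) /\ (forall e, 0 < e -> exists n, l - e < u n).
Proof.
move=> ndu; split=> [ul|[ub lb]].
  split=> [n|e e0].
    by rewrite -(cvg_lim _ ul)//; apply: nondecreasing_cvgn_le => //; apply/cvg_ex; exists l.
  move/cvgrPdist_lt : ul => /(_ e e0)[n _ /(_ n (leqnn n))] /=.
  by rewrite ltr_norml => /andP[_]; rewrite ltrBlDr -ltrBlDl => le; exists n.
apply/cvgrPdist_lt => e e0; have [n ln] := lb e e0.
exists n => // m /= nm; rewrite ger0_norm ?subr_ge0//.
by rewrite ltrBlDr -ltrBlDl (lt_le_trans ln)// ndu.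
Qed.

End monotone_limits.

(** * Vector measures and simple functions *)

Section measure_theory.
Context {R : realType} {E : povsType R} {X : topologicalType}.
Variable mu : borel_set_measure E X.
Implicit Types (A B : set X).

Lemma measure_ge0 A : borel X A -> Fin 0 <= mu A.
Proof. exact: measure_fun_ge0. Qed.

Lemma measure_mono A B : borel X A -> borel X B -> A `<=` B -> mu A <= mu B.
Proof.
move=> mA mB AB; have mBA := borelD mB mA.
have -> : B = A `|` (B `\` A).
  apply/seteqP; split=> x; last by case=> [/AB|[]].
  by have [|nA] := pselect (A x); [left|right].
rewrite Defs.measureU//; first by apply: ele_addr; exact: measure_ge0.
by rewrite setDE setICA setICr setI0.
Qed.

Lemma measure_finite A B v : borel X A -> borel X B -> A `<=` B ->
  mu B = Fin v -> exists2 u, mu A = Fin u & u <= v.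
Proof.
by move=> mA mB AB muB; apply: le_Fin; rewrite -muB; exact: measure_mono.
Qed.

Lemma measure_null_sub A B : borel X A -> borel X B -> A `<=` B ->
  mu B = Fin 0 -> mu A = Fin 0.
Proof.
move=> mA mB AB muB; apply/eqP; rewrite eq_le measure_ge0// andbT -muB.
exact: measure_mono.
Qed.

(** Simple functions are treated below as [h \o p] with [p] into a finite type, so finite additivity
    is needed over the fibres of such a map. *)
Lemma measure_fibers (T : finType) (p : X -> T) A (P : pred T) :
  borel X A -> (forall t, borel X (p @^-1` [set t])) ->
  mu (A `&` [set x | P (p x)]) = \sum_(t | P t) mu (A `&` p @^-1` [set t]).
Proof.
move=> mA mp.
have msum (s : seq T) : borel X (A `&` [set x | p x \in s]).
  elim: s => [|t s IH].
    rewrite (_ : _ `&` _ = set0); first exact: borel_set0.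
    by rewrite -subset0 => x [].
  rewrite (_ : _ `&` _ =
      (A `&` p @^-1` [set t]) `|` (A `&` [set x | p x \in s])).
    by apply: borelU => //; exact: borelI.
  rewrite -setIUr; congr (_ `&` _); apply/seteqP; split=> x /=; rewrite inE.
    by move=> /predU1P[->|]; [left|right].
  by move=> [->|->]; rewrite ?eqxx ?orbT.
have key (s : seq T) : uniq s ->
    mu (A `&` [set x | p x \in s]) = \sum_(t <- s) mu (A `&` p @^-1` [set t]).
  elim: s => [_|t s IH /= /andP[ts us]].
    rewrite big_nil (_ : _ `&` _ = set0) ?measure_fun0//.
    by rewrite -subset0 => x [].
  rewrite big_cons -(IH us) -Defs.measureU//.
  - congr (mu _); rewrite -setIUr; congr (_ `&` _).
    apply/seteqP; split=> x /=; rewrite inE.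
      by move=> /predU1P[->|]; [left|right].
    by move=> [->|->]; rewrite ?eqxx ?orbT.
  - exact: borelI.
  - by rewrite -subset0 => x /= [[_ pxt] [_]]; rewrite pxt (negbTE ts).
rewrite -big_filter -key ?filter_uniq ?index_enum_uniq//.
congr (mu (A `&` _)); apply/seteqP.
by split=> x /=; rewrite mem_filter mem_index_enum andbT.
Qed.

Lemma measure_bigcup_sup (A : nat -> set X) : (forall n, borel X (A n)) ->
  (forall m n, (m <= n)%N -> A m `<=` A n) ->
  supremums (range (fun n => mu (A n))) (mu (\bigcup_n A n)).
Proof.
(* Successive differences are disjoint, and their first [n.+1] measures sum to [mu (A n)]; the empty
   partial sum is [0] and is treated separately at the end. *)
move=> mA ndA; pose B n := if n is k.+1 then A k.+1 `\` A k else A 0%N.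
have mB n : borel X (B n) by case: n => [|n] //=; exact: borelD.
have BA n : B n `<=` A n by case: n => [|n] //= x [].
have tB : trivIset setT B.
  apply: ltn_trivIset => -[|m] n // nm /=.
  rewrite -subset0 => x [/BA Anx [_ nAm]]; apply: nAm.
  by apply: ndA Anx; rewrite -ltnS.
have UB : \bigcup_n B n = \bigcup_n A n.
  apply/seteqP; split=> x [n _]; first by move/BA; exists n.
  elim: n => [|n IH] Ax; first by exists 0%N.
  by have [/IH//|nAx] := pselect (A n x); exists n.+1.
have sumB n : \sum_(i < n.+1) mu (B i) = mu (A n).
  elim: n => [|n IH]; first by rewrite big_ord_recl big_ord0 addr0.
  rewrite big_ord_recr /= IH -Defs.measureU//; last 2 first.
  - exact: borelD.
  - by rewrite setDE setICA setICr setI0.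
  congr (mu _); apply/seteqP; split=> x; first by case=> [|[]//]; exact: ndA.
  by have [|nAx] := pselect (A n x); [left|right].
have /supremums_rangeP[ub lb] := measure_fun_sigma_additive mu mB tB.
rewrite -UB; apply/supremums_rangeP; split=> [n|y yA].
  by rewrite -sumB; exact: ub.
apply: lb => -[|n]; last by rewrite sumB.
by rewrite big_ord0; apply: le_trans (yA 0%N); exact: measure_ge0.
Qed.

Lemma measure_null_bigcup (A : nat -> set X) : (forall n, borel X (A n)) ->
  (forall n, mu (A n) = Fin 0) -> mu (\bigcup_n A n) = Fin 0.
Proof.
move=> mA A0; pose B n := \big[setU/set0]_(i < n.+1) A i.
have mB0 n : borel X (B n) /\ mu (B n) = Fin 0.
  rewrite /B; elim: n => [|n [IH1 IH2]]; first by rewrite big_ord_recl big_ord0 setU0.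
  rewrite big_ord_recr; split; [exact: borelU|exact: Defs.null_setU].
have UB : \bigcup_n B n = \bigcup_n A n.
  exact: bigcup_bigsetU_bigcup.
have ndB m n : (m <= n)%N -> B m `<=` B n by move=> mn; exact: subset_bigsetU.
have := measure_bigcup_sup (fun n => (mB0 n).1) ndB; rewrite UB => /supremums_rangeP[_ lb]; apply/eqP; rewrite eq_le measure_ge0 ?andbT.
  by apply: lb => n; rewrite (mB0 n).2.
exact: borel_bigcup.
Qed.

End measure_theory.

Section simple_functions.
Context {R : realType} {X : topologicalType}.
Implicit Types (f g phi psi : X -> R) (A : set X).

Lemma finite_range_op phi psi (op : R -> R -> R) :
  finite_set (range phi) -> finite_set (range psi) ->
  finite_set (range (fun x => op (phi x) (psi x))).
Proof.
move=> fphi fpsi.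
apply: (@sub_finite_set _ _ [set op a b | a in range phi & b in range psi]).
  by move=> _ [x _ <-]; exists (phi x); [exists x|exists (psi x) => //; exists x].
exact: finite_image2.
Qed.

Lemma simpleD phi psi : simple_nonneg phi -> simple_nonneg psi ->
  simple_nonneg (fun x => phi x + psi x).
Proof.
move=> [mp fp p0] [mq fq q0]; split; [exact: borel_measurableD| |].
  exact: finite_range_op.
by move=> x; exact: addr_ge0.
Qed.

Lemma simpleM phi psi : simple_nonneg phi -> simple_nonneg psi ->
  simple_nonneg (fun x => phi x * psi x).
Proof.
move=> [mp fp p0] [mq fq q0]; split; [exact: borel_measurableM| |].
  exact: finite_range_op.
by move=> x; exact: mulr_ge0.
Qed.

Lemma simple_cst (c : R) : 0 <= c -> simple_nonneg (fun _ : X => c).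
Proof.
move=> c0; split=> //; first exact: borel_measurable_cst.
by apply: (@sub_finite_set _ _ [set c]) => // _ [x _ <-].
Qed.

Lemma simple_indic A : borel X A -> simple_nonneg (\1_A : X -> R).
Proof.
move=> mA; split=> [||x]; first exact: borel_measurable_indic.
  by apply: (@sub_finite_set _ _ [set 0; 1]) => // _ [x _ <-];
    rewrite indicE; case: (_ \in _); [right|left].
by rewrite indicE.
Qed.

Lemma simple_fibersP phi : simple_nonneg phi ->
  exists (T : finType) (p : X -> T) (h : T -> R),
    [/\ phi = h \o p, (forall t, 0 <= h t) &
        (forall t, borel X (p @^-1` [set t]))].
Proof.
move=> [mphi fphi phi0]; pose T : finType := fset_set (range phi).
have pT x : phi x \in fset_set (range phi) by rewrite in_fset_set// mem_set.
exists T, (fun x => [` pT x]%fset), (fun t => fsval t); split=> //.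
  move=> t; have := fsvalP t; rewrite in_fset_set// => /set_mem[x _ <-].
  exact: phi0.
move=> t; rewrite (_ : _ @^-1` _ = phi @^-1` [set fsval t]).
  by apply: mphi; apply/borel_realE; exact: measurable_set1.
by apply/seteqP; split=> x /= => [<-//|xt]; apply/val_inj.
Qed.

End simple_functions.

Section simple_integral_theory.
Context {R : realType} {E : povsType R} {X : topologicalType}.
Variable mu : borel_set_measure E X.
Local Notation J := (simple_integral mu).
Implicit Types (phi psi : X -> R) (A : set X).

(** Several [t] may share the value [h t], and some fibres may be empty. The former are collected by
    additivity of [mu], the latter contribute [0]. *)
Lemma simple_integral_fibers (T : finType) (p : X -> T) (h : T -> R) :
  (forall t, borel X (p @^-1` [set t])) ->
  J (h \o p) = \sum_t escale (h t) (mu (p @^-1` [set t])).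
Proof.
move=> mp; have fin : finite_set (range (h \o p)).
  apply: (@sub_finite_set _ _ (h @` setT)); last exact: finite_image.
  by move=> _ [x _ <-]; exists (p x).
rewrite /simple_integral fsbig_finite//=.
pose s := finmap.enum_fset (fset_set (range (h \o p))).
have -> : \sum_(r <- s) escale r (mu ((h \o p) @^-1` [set r])) =
    \sum_(r <- s) \sum_t (if h t == r then escale (h t) (mu (p @^-1` [set t])) else 0).
  apply: eq_bigr => r _; rewrite -big_mkcond/=.
  have := measure_fibers mu (fun t => h t == r) (@borelT X) mp; rewrite setTI.
  rewrite (_ : [set x | _] = (h \o p) @^-1` [set r]); last first.
    by apply/seteqP; split=> x /= => [/eqP|->].
  move=> ->; rewrite escale_sum; apply: eq_bigr => t /eqP <-.
  by rewrite setTI.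
rewrite exchange_big; apply: eq_bigr => t _.
rewrite -big_mkcond/=; have [hts|hts] := boolP (h t \in s).
  by rewrite (big_rem _ hts)/= eqxx big1_seq ?addr0// => r /andP[/eqP <-];
    rewrite mem_rem_uniq ?fset_uniq// inE eqxx.
rewrite big1_seq; last by move=> r /andP[/eqP <-]; rewrite (negbTE hts).
rewrite (_ : _ @^-1` _ = set0) ?measure_fun0 ?escale0//.
rewrite -subset0 => x /= pxt; move/negP: hts; apply.
by rewrite in_fset_set// mem_set//; exists x => //=; rewrite pxt.
Qed.

Lemma simple_pair_fibers phi psi : simple_nonneg phi -> simple_nonneg psi ->
  exists (T : finType) (p : X -> T) (h k : T -> R),
    [/\ phi = h \o p, psi = k \o p, (forall t, 0 <= h t), (forall t, 0 <= k t) &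
        (forall t, borel X (p @^-1` [set t]))].
Proof.
move=> /simple_fibersP[T1 [p1 [h1 [-> h10 mp1]]]].
move=> /simple_fibersP[T2 [p2 [h2 [-> h20 mp2]]]].
exists (T1 * T2)%type, (fun x => (p1 x, p2 x)), (h1 \o fst), (h2 \o snd).
split=> [//|//|t|t|[t1 t2]]; [exact: h10|exact: h20|].
rewrite (_ : _ @^-1` _ = p1 @^-1` [set t1] `&` p2 @^-1` [set t2]).
  exact: borelI.
by apply/seteqP; split=> x /= [-> ->].
Qed.

Lemma simple_integral_ge0 phi : simple_nonneg phi -> Fin 0 <= J phi.
Proof.
move=> /simple_fibersP[T [p [h [-> h0 mp]]]]; rewrite simple_integral_fibers//.
by apply: ebar_sum_ge0 => t _; apply: escale_ge0 => //; exact: measure_ge0.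
Qed.

Lemma simple_integralD phi psi : simple_nonneg phi -> simple_nonneg psi ->
  J (fun x => phi x + psi x) = J phi + J psi.
Proof.
move=> sphi spsi.
have [T [p [h [k [-> -> h0 k0 mp]]]]] := simple_pair_fibers sphi spsi.
rewrite (_ : (fun x => _) = (fun t => h t + k t) \o p)// !simple_integral_fibers//.
by rewrite -big_split/=; apply: eq_bigr => t _; exact: escaleDl.
Qed.

Lemma simple_integral_le phi psi : simple_nonneg phi -> simple_nonneg psi ->
  (forall x, phi x <= psi x) -> J phi <= J psi.
Proof.
move=> sphi spsi.
have [T [p [h [k [-> -> h0 k0 mp]]]]] := simple_pair_fibers sphi spsi.
move=> hk; rewrite !simple_integral_fibers//; apply: ebar_sum_le => t _.
(* [h t <= k t] is known only for [t] in the image of [p]; the other fibres are empty. *)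
have [[x pxt]|np] := pselect (exists x, p x = t).
  apply: escale_le2 => //; first exact: measure_ge0.
  by rewrite -pxt; exact: hk.
rewrite (_ : _ @^-1` _ = set0) ?measure_fun0 ?escale0//.
by rewrite -subset0 => x pxt; apply: np; exists x.
Qed.

Lemma simple_integralZ (c : R) phi : 0 <= c -> simple_nonneg phi ->
  J (fun x => c * phi x) = escale c (J phi).
Proof.
move=> c0 /simple_fibersP[T [p [h [-> h0 mp]]]].
rewrite (_ : (fun x => _) = (fun t => c * h t) \o p)// !simple_integral_fibers//.
by rewrite escale_sum; apply: eq_bigr => t _; rewrite escaleA.
Qed.

Lemma simple_integral_indic A : borel X A -> J \1_A = mu A.
Proof.
move=> mA; pose p x := x \in A; pose h (b : bool) : R := b%:R.
rewrite (_ : \1_A = h \o p); last by apply/funext => x; rewrite indicE.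
have pt : p @^-1` [set true] = A by apply/seteqP; split=> x; [exact: set_mem|exact: mem_set].
have pf : p @^-1` [set false] = ~` A.
  apply/seteqP; split=> x /=; first by move/negbT; rewrite notin_setE.
  by move=> nA; apply/negbTE; rewrite notin_setE.
rewrite simple_integral_fibers; last first.
  by case; rewrite ?pt ?pf//; exact: borelC.
by rewrite big_bool/= pt pf /h escale1 escale0l addr0.
Qed.

Lemma simple_integral_null phi A : simple_nonneg phi -> borel X A ->
  mu A = Fin 0 -> (forall x, ~ A x -> phi x = 0) -> J phi = Fin 0.
Proof.
move=> /simple_fibersP[T [p [h [-> h0 mp]]]] mA A0 phi0.
rewrite simple_integral_fibers// big1// => t _.
have [->|ht] := eqVneq (h t) 0; first by rewrite escale0l.
rewrite (@measure_null_sub _ _ _ mu _ A) ?escale0// => x /= pxt.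
by apply: contrapT => /phi0/= /eqP; rewrite pxt (negbTE ht).
Qed.

(** Continuity from below of [mu] on each of the finitely many fibres, multiplied by the constants
    [h t] and summed. *)
Lemma simple_integral_sup phi (A : nat -> set X) : simple_nonneg phi ->
  (forall n, borel X (A n)) -> (forall m n, (m <= n)%N -> A m `<=` A n) ->
  \bigcup_n A n = setT ->
  supremums (range (fun n => J (fun x => phi x * \1_(A n) x))) (J phi).
Proof.
move=> sphi mA ndA UA; have [T [p [h [phiE h0 mp]]]] := simple_fibersP sphi.
have JE n : J (fun x => phi x * \1_(A n) x) =
    \sum_t escale (h t) (mu (A n `&` p @^-1` [set t])).
  pose q x := (p x, x \in A n); pose k (u : T * bool) := h u.1 * (u.2)%:R.
  rewrite (_ : (fun x => _) = k \o q); last first.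
    by rewrite phiE; apply/funext => x; rewrite indicE.
  have qE t (b : bool) : q @^-1` [set (t, b)] =
      (if b then A n else ~` A n) `&` p @^-1` [set t].
    apply/seteqP; split=> x /=.
      move=> [-> xb]; split=> //; case: b xb => /=; first by move/set_mem.
      by move/negbT; rewrite notin_setE.
    move=> [xb xt]; rewrite /q xt; congr pair; case: b xb; first by move/mem_set.
    by move=> nA; apply/negbTE; rewrite notin_setE.
  rewrite simple_integral_fibers; last first.
    move=> [t b]; rewrite qE; apply: borelI => //.
    by case: b => //; exact: borelC.
  transitivity (\sum_t \sum_(b : bool) escale (k (t, b)) (mu (q @^-1` [set (t, b)]))).
    by rewrite pair_bigA/=; apply: eq_bigr => -[].
  apply: eq_bigr => t _; rewrite big_bool/= qE /k/= mulr1 mulr0 escale0l.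
  by rewrite addr0.
rewrite (_ : (fun n => _) = (fun n => \sum_t escale (h t) (mu (A n `&` p @^-1` [set t])))); last first.
  exact/funext.
rewrite phiE simple_integral_fibers//.
apply: (@supremums_ebar_sum _ _ _ _ _ (fun t n => escale (h t) (mu (A n `&` p @^-1` [set t])))) => t _.
  move=> m n mn; apply: escale_le => //; apply: measure_mono; [exact: borelI..|].
  by apply: setSI; exact: ndA.
apply: supremums_escale => //; first by constructor; exact: 0%N.
rewrite -{2}(setTI (p @^-1` [set t])) -UA setI_bigcupl.
by apply: measure_bigcup_sup => [n|m n mn]; [exact: borelI|apply: setSI; exact: ndA].
Qed.

End simple_integral_theory.

(** * The order integral *)

Lemma nondecreasing_cvg_leM (R : realType) (u : nat -> R) (l a c : R) :
  nondecreasing_seq u -> u @ \oo --> l -> 0 <= u 0%N -> 0 <= a <= l ->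
  0 <= c -> c < 1 -> exists n, c * a <= u n.
Proof.
move=> ndu ul u0 /andP[a0 al] c0 c1.
have [_ lb] := (nondecreasing_cvgP _ ndu).1 ul.
move: a0; rewrite le_eqVlt => /predU1P[<-|a0]; first by exists 0%N; rewrite mulr0.
(* The error [(1 - c) * a] is chosen so that [l - (1 - c) * a] is at least [c * a]. *)
have [|n nl] := lb ((1 - c) * a); first by rewrite mulr_gt0// subr_gt0.
exists n; apply: le_trans (ltW nl); rewrite mulrBl mul1r opprB addrCA.
by rewrite lerDl subr_ge0.
Qed.

Section order_integral_theory.
Context {R : realType} {E : povsType R} {X : topologicalType}.
Variable mu : borel_set_measure E X.
Hypothesis mcE : monotone_complete E.
Local Notation J := (simple_integral mu).
Local Notation OI f := (order_integral mu (fun x => (f x)%:E)).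
Implicit Types (f g phi psi : X -> R) (A : set X) (y : adjoin_infty E).

(** Letting [c] run through [1 - 1 / (n + 1)] leaves errors [a / (n + 1)], which the Archimedean
    property removes. For [x = Infty] a single positive factor suffices, and [1 / 2] is taken. *)
Lemma ebar_archimedean (x y : adjoin_infty E) : Fin 0 <= x ->
  (forall c : R, 0 <= c -> c < 1 -> escale c x <= y) -> x <= y.
Proof.
case: y => [v|]; last by rewrite le_Infty.
case: x => [a|] a0 H; last first.
  have h0 : 0 <= 2^-1 :> R by rewrite invr_ge0.
  have := H (2^-1) h0; rewrite /= invr_eq0 pnatr_eq0/=; apply.
  by rewrite invf_lt1// ltr1n.
rewrite Fin_le -povs_subr_ge0 -povs_leN oppr0 opprB.
apply: (@povs_le_scale_inv _ _ a) => // n.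
have c0 : 0 <= 1 - n.+1%:R^-1 :> R by rewrite subr_ge0 invf_le1// ler1n.
have c1 : 1 - n.+1%:R^-1 < 1 :> R by rewrite ltrBlDr ltrDl invr_gt0.
have := H _ c0 c1; rewrite /= Fin_le scalerBl scale1r povs_leBlDr.
by rewrite povs_leBlDr addrC.
Qed.

(* The idea of the monotone convergence theorem: on the increasing sets where
   [c * psi <= f n], the integral of [c * psi] is at most [y]; now let [n] tend
   to infinity and then [c] to [1]. *)
Lemma simple_integral_le_lim (f : nat -> X -> R) psi y : simple_nonneg psi ->
  (forall n, borel_measurable (f n)) -> (forall n x, 0 <= f n x) ->
  (forall x, nondecreasing_seq (f ^~ x)) ->
  (forall x c, 0 <= c -> c < 1 -> exists n, c * psi x <= f n x) ->
  (forall n phi, simple_nonneg phi -> (forall x, phi x <= f n x) -> J phi <= y) ->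
  J psi <= y.
Proof.
move=> spsi mf f0 ndf psif fy.
have [mpsi _ psi0] := spsi.
apply: ebar_archimedean => [|c c0 c1]; first exact: simple_integral_ge0.
pose A n := [set x | c * psi x <= f n x].
have mA n : borel X (A n).
  by apply: borel_le => //; apply: borel_measurableM => //; exact: borel_measurable_cst.
have ndA m n : (m <= n)%N -> A m `<=` A n.
  by move=> mn x /= /le_trans; apply; exact: ndf.
have UA : \bigcup_n A n = setT.
  by rewrite -subTset => x _; have [n] := psif x c c0 c1; exists n.
have := simple_integral_sup mu spsi mA ndA UA.
move=> /(supremums_escale (inhabits 0%N) c0) /supremums_rangeP[_]; apply => n.
have sA : simple_nonneg (fun x => psi x * \1_(A n) x).
  by apply: simpleM => //; exact: simple_indic.
rewrite -simple_integralZ//; apply: (fy n).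
  by apply: simpleM => //; exact: simple_cst.
move=> x; rewrite indicE; have [/set_mem|_] := boolP (x \in A n).
  by rewrite mulr1.
by rewrite !mulr0.
Qed.

(** The set from which [xget] chooses is not empty, since monotone completeness gives a supremum for
    the integrals of one approximating sequence. The sequence obtained here is the one behind the
    chosen value. *)
Lemma order_integral_approx f : borel_measurable f -> (forall x, 0 <= f x) ->
  exists phi : nat -> X -> R,
    [/\ (forall n, simple_nonneg (phi n)),
        (forall x, nondecreasing_seq (fun n => phi n x)),
        (forall x, (fun n => phi n x) @ \oo --> f x) &
        supremums (range (fun n => J (phi n))) (OI f)].
Proof.
move=> mf f0; have [phi [sphi ndphi phif]] := borel_measurable_approx mf f0.
have [|n|y phiy] := @monotone_complete_ebar _ E (fun n => J (phi n)) mcE.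
- by move=> m n mn; apply: simple_integral_le => // x; exact: ndphi.
- exact: simple_integral_ge0.
rewrite /order_integral; case: xgetP => [z _ [psi [spsi ndpsi psif psiy]]|/(_ y)].
  exists psi; split=> // x; have := psif x.
  by move=> /fine_cvgP[].
case; exists phi; split=> // x.
by apply: cvg_EFin; [exact: nearW|exact: phif].
Qed.

(** Together with [order_integral_lub] this exhibits the integral as the supremum over all simple
    functions below [f], and so frees it from the sequence chosen in its definition. *)
Lemma le_order_integral f phi : borel_measurable f -> (forall x, 0 <= f x) ->
  simple_nonneg phi -> (forall x, phi x <= f x) -> J phi <= OI f.
Proof.
move=> mf f0 sphi phif.
have [psi [spsi ndpsi psif /supremums_rangeP[ub _]]] := order_integral_approx mf f0.
apply: (simple_integral_le_lim (f := psi)) => //.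
- by move=> n; case: (spsi n).
- by move=> n; case: (spsi n).
- move=> x c c0 c1; apply: nondecreasing_cvg_leM (ndpsi x) (psif x) _ _ c0 c1.
    by case: (spsi 0%N).
  by rewrite phif andbT; case: sphi.
- move=> n chi schi chipsi; apply: le_trans (ub n).
  exact: simple_integral_le.
Qed.

Lemma order_integral_lub f y : borel_measurable f -> (forall x, 0 <= f x) ->
  (forall phi, simple_nonneg phi -> (forall x, phi x <= f x) -> J phi <= y) ->
  OI f <= y.
Proof.
move=> mf f0 fy.
have [psi [spsi ndpsi psif /supremums_rangeP[_ lb]]] := order_integral_approx mf f0.
apply: lb => n; apply: fy => // x.
by have [ub _] := (nondecreasing_cvgP _ (ndpsi x)).1 (psif x).
Qed.

Lemma order_integral_ge0 f : borel_measurable f -> (forall x, 0 <= f x) ->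
  Fin 0 <= OI f.
Proof.
move=> mf f0; have s0 := @simple_cst R X 0 (lexx 0).
apply: le_trans (le_order_integral mf f0 s0 f0).
exact: simple_integral_ge0.
Qed.

Lemma order_integral_le f g : borel_measurable f -> borel_measurable g ->
  (forall x, 0 <= f x) -> (forall x, f x <= g x) -> OI f <= OI g.
Proof.
move=> mf mg f0 fg; apply: order_integral_lub => // phi sphi phif.
apply: le_order_integral => // x; first exact: le_trans (f0 x) (fg x).
exact: le_trans (phif x) (fg x).
Qed.

Lemma order_integral_simple phi : simple_nonneg phi -> OI phi = J phi.
Proof.
move=> sphi; have [mphi _ phi0] := sphi.
apply/eqP; rewrite eq_le le_order_integral// andbT.
by apply: order_integral_lub => // psi spsi; exact: simple_integral_le.
Qed.

Lemma order_integral_mct (f : nat -> X -> R) g : (forall n, borel_measurable (f n)) ->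
  (forall n x, 0 <= f n x) -> (forall x, nondecreasing_seq (f ^~ x)) ->
  (forall x, f ^~ x @ \oo --> g x) ->
  supremums (range (fun n => OI (f n))) (OI g).
Proof.
move=> mf f0 ndf fg; have mg := borel_measurable_cvg mf fg.
have fleg n x : f n x <= g x by have [] := (nondecreasing_cvgP _ (ndf x)).1 (fg x).
have g0 x : 0 <= g x := le_trans (f0 0%N x) (fleg 0%N x).
apply/supremums_rangeP; split=> [n|y fy]; first exact: order_integral_le.
apply: order_integral_lub => // psi spsi psig.
apply: (simple_integral_le_lim (f := f)) => //.
  move=> x c c0 c1; apply: nondecreasing_cvg_leM (ndf x) (fg x) _ _ c0 c1 => //.
  by rewrite psig andbT; case: spsi.
move=> n phi sphi phif; apply: le_trans (fy n); exact: le_order_integral.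
Qed.

Lemma order_integralD f g : borel_measurable f -> borel_measurable g ->
  (forall x, 0 <= f x) -> (forall x, 0 <= g x) ->
  OI (fun x => f x + g x) = OI f + OI g.
Proof.
move=> mf mg f0 g0.
have [phi [sphi ndphi phif phiy]] := order_integral_approx mf f0.
have [psi [spsi ndpsi psig psiy]] := order_integral_approx mg g0.
have ndJ (u : nat -> X -> R) : (forall n, simple_nonneg (u n)) ->
    (forall x, nondecreasing_seq (u ^~ x)) -> nondecreasing_seq (fun n => J (u n)).
  by move=> su ndu m n mn; apply: simple_integral_le => // x; exact: ndu.
(* Both sides are suprema of the same sequence, once by adding suprema and once by monotone
   convergence. *)
have := supremums_eadd (ndJ _ sphi ndphi) (ndJ _ spsi ndpsi) phiy psiy.
apply: supremums_unique.
have -> : (fun n => J (phi n) + J (psi n)) =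
    (fun n => OI (fun x => phi n x + psi n x)).
  apply/funext => n; rewrite -simple_integralD// order_integral_simple//.
  exact: simpleD.
apply: order_integral_mct.
- by move=> n; case: (simpleD (sphi n) (spsi n)).
- by move=> n; case: (simpleD (sphi n) (spsi n)).
- by move=> x m n mn; apply: lerD; [exact: ndphi|exact: ndpsi].
- by move=> x; apply: cvgD.
Qed.

Lemma order_integralZ (c : R) f : borel_measurable f -> (forall x, 0 <= f x) ->
  0 <= c -> OI (fun x => c * f x) = escale c (OI f).
Proof.
move=> mf f0 c0.
have [phi [sphi ndphi phif phiy]] := order_integral_approx mf f0.
have := supremums_escale (inhabits 0%N) c0 phiy.
apply: supremums_unique.
have scphi n : simple_nonneg (fun x => c * phi n x).
  by apply: simpleM => //; exact: simple_cst.
have -> : (fun n => escale c (J (phi n))) = (fun n => OI (fun x => c * phi n x)).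
  by apply/funext => n; rewrite -simple_integralZ// order_integral_simple.
apply: order_integral_mct.
- by move=> n; case: (scphi n).
- by move=> n; case: (scphi n).
- by move=> x m n mn; apply: ler_wpM2l => //; exact: ndphi.
- by move=> x; apply: cvgMr.
Qed.

Lemma order_integral_indic A : borel X A -> OI \1_A = mu A.
Proof.
move=> mA; rewrite -(simple_integral_indic mu mA) -order_integral_simple//.
exact: simple_indic.
Qed.

Lemma order_integral_null f A : borel_measurable f -> (forall x, 0 <= f x) ->
  borel X A -> mu A = Fin 0 -> (forall x, ~ A x -> f x = 0) -> OI f = Fin 0.
Proof.
move=> mf f0 mA A0 fA; apply/eqP; rewrite eq_le order_integral_ge0// andbT.
apply: order_integral_lub => // phi sphi phif.
rewrite (simple_integral_null sphi mA A0)// => x nAx.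
have := phif x; rewrite fA// => phi_le.
by apply/eqP; rewrite eq_le phi_le/=; case: sphi => _ _; exact.
Qed.

Lemma order_integral_ae f g : borel_measurable f -> borel_measurable g ->
  (forall x, 0 <= f x) -> (forall x, 0 <= g x) -> oae mu (fun x => f x = g x) ->
  OI f = OI g.
Proof.
move=> mf mg f0 g0 [N [mN N0 fgN]].
have mI A : borel X A -> borel_measurable (\1_A : X -> R).
  exact: borel_measurable_indic.
(* Multiplying by the indicator of the complement of [N] does not change the integral and makes the
   two functions equal everywhere. *)
have split_N (h : X -> R) : borel_measurable h -> (forall x, 0 <= h x) ->
    OI h = OI (fun x => h x * \1_(~` N) x).
  move=> mh h0; have mhN A : borel X A -> borel_measurable (fun x => h x * \1_A x).
    by move=> mA; apply: borel_measurableM => //; exact: mI.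
  have -> : (fun x => (h x)%:E) = (fun x => (h x * \1_(~` N) x + h x * \1_N x)%:E).
    apply/funext => x; congr EFin; rewrite -mulrDr !indicE in_setC.
    by case: (x \in N); rewrite /= ?add0r ?addr0 mulr1.
  have hI A x : 0 <= h x * \1_A x by rewrite mulr_ge0// indicE.
  rewrite order_integralD//; [|apply: mhN; exact: borelC|exact: mhN].
  rewrite [X in _ + X](@order_integral_null _ N) ?addr0//; first exact: mhN.
  by move=> x nNx; rewrite indicE memNset// mulr0.
rewrite split_N// [RHS]split_N//; congr (order_integral _ _).
apply/funext => x; congr EFin; rewrite !indicE.
have [/set_mem/= nNx|_] := boolP (x \in ~` N); last by rewrite !mulr0.
by congr (_ * _); apply: contrapT => /fgN.
Qed.

End order_integral_theory.

(** * Integrable functions and monotone convergence for [Imu] *)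

Section integrable_functions.
Context {R : realType} {E : povsType R} {X : topologicalType}.
Variable mu : borel_set_measure E X.
Hypothesis mcE : monotone_complete E.
Local Notation OI f := (order_integral mu (fun x => (f x)%:E)).
Local Notation L1p := (ointegrable_nonneg mu).
Local Notation I := (Imu mu).
Implicit Types (f g h : X -> R) (A : set X) (v : E).

Lemma ointegrable_nonnegP f : L1p f <->
  [/\ borel_measurable f, (forall x, 0 <= f x) & efinite (OI f)].
Proof.
rewrite /ointegrable_nonneg /ointegrable /=.
have nf : (forall x, 0 <= f x) -> (fun x => `|f x|%:E) = (fun x => (f x)%:E).
  by move=> f0; apply/funext => x; rewrite ger0_norm.
by split=> [[[mf fin] f0]|[mf f0 fin]]; [rewrite nf in fin|rewrite nf].
Qed.

Lemma order_integral0 : OI (fun _ => 0) = Fin 0.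
Proof.
apply: (@order_integral_null _ _ _ _ mcE _ set0) => //.
- exact: borel_measurable_cst.
- exact: borel_set0.
- exact: measure_fun0.
Qed.

Lemma Imu_nonneg f : (forall x, 0 <= f x) -> I f = efine (OI f).
Proof.
move=> f0; rewrite /Imu.
have -> : EFin \o f^\+ = (fun x => (f x)%:E).
  by apply/funext => x; rewrite /= /funrpos; congr EFin; apply/max_idPl.
have -> : EFin \o f^\- = (fun x => 0%:E).
  by apply/funext => x; rewrite /= /funrneg; congr EFin; apply/max_idPr; rewrite oppr_le0.
by rewrite order_integral0 subr0.
Qed.

Lemma order_integral_Imu f : L1p f -> OI f = Fin (I f).
Proof. by move=> /ointegrable_nonnegP[_ f0 [v fv]]; rewrite Imu_nonneg// fv. Qed.

Lemma order_integral_finite f v : borel_measurable f -> (forall x, 0 <= f x) ->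
  OI f = Fin v -> L1p f /\ I f = v.
Proof.
move=> mf f0 fv; split; last by rewrite Imu_nonneg// fv.
by apply/ointegrable_nonnegP; split=> //; exists v.
Qed.

Lemma L1p_measurable f : L1p f -> borel_measurable f.
Proof. by case=> -[]. Qed.

Lemma L1p_ge0 f : L1p f -> forall x, 0 <= f x.
Proof. by case. Qed.

Lemma L1p_dom f g : borel_measurable f -> (forall x, 0 <= f x) ->
  (forall x, f x <= g x) -> L1p g -> L1p f.
Proof.
move=> mf f0 fg Lg; have := order_integral_le mu mcE mf (L1p_measurable Lg) f0 fg.
rewrite (order_integral_Imu Lg) => /le_Fin[v fv _].
by have [] := order_integral_finite mf f0 fv.
Qed.

Lemma Imu_le f g : L1p f -> L1p g -> (forall x, f x <= g x) -> I f <= I g.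
Proof.
move=> Lf Lg fg; rewrite -Fin_le -!order_integral_Imu//.
by apply: order_integral_le; [| exact: L1p_measurable|exact: L1p_measurable|
  exact: L1p_ge0|].
Qed.

Lemma Imu_ge0 f : L1p f -> 0 <= I f.
Proof.
move=> Lf; rewrite -Fin_le -order_integral_Imu//.
by apply: order_integral_ge0; [|exact: L1p_measurable|exact: L1p_ge0].
Qed.

Lemma L1p_add f g : L1p f -> L1p g ->
  L1p (fun x => f x + g x) /\ I (fun x => f x + g x) = I f + I g.
Proof.
move=> Lf Lg; apply: order_integral_finite.
- by apply: borel_measurableD; exact: L1p_measurable.
- by move=> x; apply: addr_ge0; exact: L1p_ge0.
- rewrite order_integralD ?order_integral_Imu//; try exact: L1p_measurable.
    exact: L1p_ge0.
  exact: L1p_ge0.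
Qed.

Lemma L1pD f g : L1p f -> L1p g -> L1p (fun x => f x + g x).
Proof. by move=> Lf Lg; case: (L1p_add Lf Lg). Qed.

Lemma ImuD f g : L1p f -> L1p g -> I (fun x => f x + g x) = I f + I g.
Proof. by move=> Lf Lg; case: (L1p_add Lf Lg). Qed.

Lemma L1p_scale (c : R) f : 0 <= c -> L1p f ->
  L1p (fun x => c * f x) /\ I (fun x => c * f x) = c *: I f.
Proof.
move=> c0 Lf; apply: order_integral_finite.
- apply: borel_measurableM; first exact: borel_measurable_cst.
  exact: L1p_measurable.
- by move=> x; apply: mulr_ge0 => //; exact: L1p_ge0.
- rewrite order_integralZ ?order_integral_Imu//; first exact: L1p_measurable.
  exact: L1p_ge0.
Qed.

Lemma L1pZ (c : R) f : 0 <= c -> L1p f -> L1p (fun x => c * f x).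
Proof. by move=> c0 Lf; case: (L1p_scale c0 Lf). Qed.

Lemma ImuZ (c : R) f : 0 <= c -> L1p f -> I (fun x => c * f x) = c *: I f.
Proof. by move=> c0 Lf; case: (L1p_scale c0 Lf). Qed.

Lemma L1p0 : L1p (fun _ => 0).
Proof.
have [] // := @order_integral_finite (fun _ => 0) 0.
- exact: borel_measurable_cst.
- exact: order_integral0.
Qed.

Lemma Imu0 : I (fun _ => 0) = 0.
Proof. by rewrite Imu_nonneg// order_integral0. Qed.

Lemma L1pB f g : L1p f -> L1p g -> (forall x, g x <= f x) ->
  L1p (fun x => f x - g x).
Proof.
move=> Lf Lg gf; apply: (L1p_dom _ _ _ Lf).
- by apply: borel_measurableB; exact: L1p_measurable.
- by move=> x; rewrite subr_ge0.
- by move=> x; rewrite gerBl L1p_ge0.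
Qed.

Lemma ImuB f g : L1p f -> L1p g -> (forall x, g x <= f x) ->
  I (fun x => f x - g x) = I f - I g.
Proof.
move=> Lf Lg gf; apply/eqP; rewrite eq_sym subr_eq -ImuD//; last exact: L1pB.
by apply/eqP; congr I; apply/funext => x; rewrite subrK.
Qed.

Lemma L1p_max f g : L1p f -> L1p g -> L1p (fun x => Num.max (f x) (g x)).
Proof.
move=> Lf Lg; apply: L1p_dom (L1pD Lf Lg).
- by apply: borel_measurable_max; exact: L1p_measurable.
- by move=> x; rewrite le_max (L1p_ge0 Lf).
- by move=> x; rewrite ge_max lerDl lerDr (L1p_ge0 Lf) (L1p_ge0 Lg).
Qed.

Lemma L1p_min f g : L1p f -> L1p g -> L1p (fun x => Num.min (f x) (g x)).
Proof.
move=> Lf Lg; apply: (L1p_dom _ _ _ Lf).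
- by apply: borel_measurable_min; exact: L1p_measurable.
- by move=> x; rewrite le_min (L1p_ge0 Lf) (L1p_ge0 Lg).
- by move=> x; rewrite ge_min lexx.
Qed.

Lemma L1p_dist f g : L1p f -> L1p g -> L1p (fun x => `|f x - g x|).
Proof.
move=> Lf Lg; apply: L1p_dom (L1pD Lf Lg).
- by apply: borel_measurable_norm; apply: borel_measurableB; exact: L1p_measurable.
- by [].
- move=> x; apply: le_trans (ler_normB _ _) _.
  by rewrite !ger0_norm// L1p_ge0.
Qed.

Lemma L1p_indic A v : borel X A -> mu A = Fin v -> L1p \1_A /\ I \1_A = v.
Proof.
move=> mA Av; apply: order_integral_finite.
- exact: borel_measurable_indic.
- by move=> x; rewrite indicE.
- by rewrite order_integral_indic.
Qed.

Lemma L1p_approx f : L1p f -> exists phi : nat -> X -> R,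
  [/\ (forall n, simple_nonneg (phi n)), (forall n, L1p (phi n)),
      (forall x, nondecreasing_seq (phi ^~ x)), (forall n x, phi n x <= f x) &
      supremums (range (fun n => I (phi n))) (I f)].
Proof.
move=> Lf; have := order_integral_approx mu mcE (L1p_measurable Lf) (L1p_ge0 Lf).
move=> [phi [sphi ndphi phif Jphi]]; exists phi.
have phi_le n x : phi n x <= f x.
  by have [] := (nondecreasing_cvgP _ (ndphi x)).1 (phif x).
have Lphi n : L1p (phi n) by apply: (L1p_dom _ _ _ Lf) => //; case: (sphi n).
split=> //; apply/(supremums_Fin _ _ (inhabits 0%N)).
rewrite -order_integral_Imu//.
suff <- : (fun n => simple_integral mu (phi n)) = (fun n => Fin (I (phi n))) by [].
by apply/funext => n; rewrite -order_integral_Imu// order_integral_simple.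
Qed.

Lemma Imu_mct (f : nat -> X -> R) g v : (forall n, L1p (f n)) ->
  (forall x, nondecreasing_seq (f ^~ x)) -> (forall x, f ^~ x @ \oo --> g x) ->
  (forall n, I (f n) <= v) ->
  L1p g /\ supremums (range (fun n => I (f n))) (I g).
Proof.
move=> Lf ndf fg fv.
have mf n := L1p_measurable (Lf n); have f0 n := L1p_ge0 (Lf n).
have sup := order_integral_mct mu mcE mf f0 ndf fg.
have [ub lb] := (supremums_rangeP _ _).1 sup.
have [w gw _] : exists2 w, OI g = Fin w & w <= v.
  apply: le_Fin; apply: lb => n; rewrite order_integral_Imu//; exact: fv.
have g0 x : 0 <= g x.
  have [fg_ _] := (nondecreasing_cvgP _ (ndf x)).1 (fg x).
  exact: le_trans (f0 0%N x) (fg_ 0%N).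
have [Lg Ig] := order_integral_finite (borel_measurable_cvg mf fg) g0 gw.
split=> //; apply/(supremums_Fin _ _ (inhabits 0%N)); rewrite Ig -gw.
suff <- : (fun n => OI (f n)) = (fun n => Fin (I (f n))) by [].
by apply/funext => n; exact: order_integral_Imu.
Qed.

(** Reduced to the increasing sequence [f 0 - f n], whose integrals are bounded by that of [f 0]. *)
Lemma Imu_mct_decreasing (f : nat -> X -> R) g : (forall n, L1p (f n)) ->
  (forall x, nonincreasing_seq (f ^~ x)) -> (forall x, f ^~ x @ \oo --> g x) ->
  L1p g /\ infimums (range (fun n => I (f n))) (I g).
Proof.
move=> Lf nif fg; pose h n x := f 0%N x - f n x; pose k x := f 0%N x - g x.
have f_le n x : f n x <= f 0%N x by exact: nif.
have Lh n : L1p (h n) by exact: L1pB.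
have Ih n : I (h n) = I (f 0%N) - I (f n) by exact: ImuB.
have [|||Lk Ik] := @Imu_mct h k (I (f 0%N)) Lh.
- by move=> x m n mn; rewrite lerD2l lerN2; exact: nif.
- by move=> x; apply: cvgB; [exact: cvg_cst|exact: fg].
- by move=> n; rewrite Ih povs_leBlDr -{1}(addr0 (I _)) povs_leD2lE Imu_ge0.
have kf x : k x <= f 0%N x.
  rewrite gerBl -(cvg_lim _ (fg x))//; apply: limr_ge.
    by apply/cvg_ex; exists (g x); exact: fg.
  by apply: nearW => n; exact: L1p_ge0.
have gE : g = (fun x => f 0%N x - k x) by apply/funext => x; rewrite subKr.
have Lg : L1p g by rewrite gE; exact: L1pB.
split=> //; have -> : I g = I (f 0%N) - I k by rewrite gE ImuB.
have := infimums_range_sub (I (f 0%N)) Ik.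
suff <- : (fun n => I (f 0%N) - I (h n)) = (fun n => I (f n)) by [].
by apply/funext => n; rewrite Ih subKr.
Qed.

Lemma Imu_ae f g : L1p f -> borel_measurable g -> (forall x, 0 <= g x) ->
  oae mu (fun x => f x = g x) -> L1p g /\ I g = I f.
Proof.
move=> Lf mg g0 fg; apply: order_integral_finite => //.
rewrite -order_integral_Imu//; apply/esym/order_integral_ae => //.
  exact: L1p_measurable.
exact: L1p_ge0.
Qed.

Lemma Imu_le_ae f g : L1p f -> L1p g -> oae mu (fun x => f x <= g x) -> I f <= I g.
Proof.
move=> Lf Lg fg; have Lm := L1p_min Lf Lg.
have [|_ <-] := Imu_ae Lf (L1p_measurable Lm) (L1p_ge0 Lm).
  by apply: (aeI _ fg fg) => x fgx _; apply/esym/min_idPl.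
by apply: Imu_le => // x; rewrite ge_min lexx orbT.
Qed.

(** Markov's inequality. As a multiple of [Infty] by [c > 0] is [Infty], it also shows that [A] has
    finite measure when [f] is integrable and [c > 0]. *)
Lemma order_integral_markov f A (c : R) : borel_measurable f ->
  (forall x, 0 <= f x) -> borel X A -> 0 <= c -> (forall x, A x -> c <= f x) ->
  escale c (mu A) <= OI f.
Proof.
move=> mf f0 mA c0 cf; rewrite -(order_integral_indic _ mcE mA).
have m1 := @borel_measurable_indic R _ _ mA.
have i0 x : 0 <= \1_A x :> R by rewrite indicE.
rewrite -(order_integralZ _ mcE m1 i0 c0); apply: order_integral_le => //.
- by apply: borel_measurableM => //; exact: borel_measurable_cst.
- by move=> x; exact: mulr_ge0.
- move=> x; rewrite indicE; have [/set_mem Ax|_] := boolP (x \in A).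
    by rewrite mulr1; exact: cf.
  by rewrite mulr0.
Qed.

(** Strict positivity of the integral: Markov's inequality makes each set where [f] is at least
    [1 / (n + 1)] null, and these sets exhaust the points where [f] is not zero. *)
Lemma Imu_eq0 f : L1p f -> I f = 0 -> oae mu (fun x => f x = 0).
Proof.
move=> Lf If0; pose A n := [set x | n.+1%:R^-1 <= f x].
have mf := L1p_measurable Lf; have f0 := L1p_ge0 Lf.
have mA n : borel X (A n) by apply: borel_le => //; exact: borel_measurable_cst.
exists (\bigcup_n A n); split; first exact: borel_bigcup.
  apply: measure_null_bigcup => // n.
  apply/eqP; rewrite eq_le measure_ge0// andbT.
  have n0 : 0 < n.+1%:R^-1 :> R by rewrite invr_gt0.
  rewrite -(escale_leE _ _ n0) escale0 -If0 -order_integral_Imu//.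
  by apply: order_integral_markov => //; exact: ltW.
move=> x /= /eqP fx0; have fx : 0 < f x by rewrite lt0r fx0 f0.
have [n nx] := ltr_add_invr fx; exists n => //=.
by move: nx; rewrite add0r => /ltW.
Qed.

(** The pointwise supremum may be infinite, while integrable functions are real-valued. By Markov's
    inequality it is infinite only on a null set, and the functions are set to [0] there before the
    limit is taken. *)
Lemma L1p_sup_seq (f : nat -> X -> R) v : (forall n, L1p (f n)) ->
  (forall x, nondecreasing_seq (f ^~ x)) -> (forall n, I (f n) <= v) ->
  exists2 g, L1p g & supremums (range (fun n => I (f n))) (I g).
Proof.
move=> Lf ndf fv; have mf n := L1p_measurable (Lf n).
have f0 n := L1p_ge0 (Lf n).
have v0 : 0 <= v := le_trans (Imu_ge0 (Lf 0%N)) (fv 0%N).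
(* [B k] is where some [f n] reaches [k + 1], and [N], the intersection of all [B k], is where the
   sequence is unbounded. *)
pose A k n := [set x | k.+1%:R <= f n x]; pose B k := \bigcup_n A k n.
pose N := ~` \bigcup_k ~` B k.
have mA k n : borel X (A k n) by apply: borel_le => //; exact: borel_measurable_cst.
have mB k : borel X (B k) by exact: borel_bigcup.
have mN : borel X N by apply: borelC; apply: borel_bigcup => k; exact: borelC.
have NB k : N `<=` B k by move=> x Nx; apply: contrapT => nB; apply: Nx; exists k.
have muB k : mu (B k) <= Fin (k.+1%:R^-1 *: v).
  have k0 : 0 < k.+1%:R :> R by rewrite ltr0n.
  have ndA m n : (m <= n)%N -> A k m `<=` A k n.
    by move=> mn x /= /le_trans; apply; exact: ndf.
  have [_] := (supremums_rangeP _ _).1 (measure_bigcup_sup mu (mA k) ndA); apply=> n.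
  rewrite -(escale_leE _ _ k0) /= scalerA mulfV ?gt_eqF// scale1r.
  apply: le_trans (_ : OI (f n) <= _); last first.
    by rewrite order_integral_Imu//; exact: fv.
  by apply: order_integral_markov => //; exact: ltW.
(* The bounds [v / (k + 1)] force [mu N] to be [0] because [E] is Archimedean. *)
have muN : mu N = Fin 0.
  have le_muN k : mu N <= Fin (k.+1%:R^-1 *: v).
    by apply: le_trans (muB k); exact: measure_mono.
  have [w wE _] := le_Fin (le_muN 0%N); rewrite wE; congr Fin; apply/eqP.
  have w0 : 0 <= w by rewrite -Fin_le -wE measure_ge0.
  rewrite eq_le w0 andbT.
  by apply: (povs_le_scale_inv v0) => k; rewrite -Fin_le -wE.
pose f' n x := f n x * \1_(~` N) x.
have mf' n : borel_measurable (f' n).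
  by apply: borel_measurableM => //; apply: borel_measurable_indic; exact: borelC.
have f'0 n x : 0 <= f' n x by rewrite mulr_ge0// indicE.
have f'E n : L1p (f' n) /\ I (f' n) = I (f n).
  apply: Imu_ae => //; exists N; split=> // x /= fx; apply: contrapT => nNx.
  by apply: fx; rewrite /f' indicE mem_set// mulr1.
have ndf' x : nondecreasing_seq (f' ^~ x).
  by move=> m n mn; apply: ler_wpM2r; [rewrite indicE|exact: ndf].
have cf' x : cvgn (f' ^~ x).
  apply: nondecreasing_is_cvgn => //.
  have [Nx|nNx] := pselect (N x).
    by exists 0 => _ [n _ <-]; rewrite /f' indicE memNset ?mulr0//=; apply.
  have [k _ nBk] : (\bigcup_k ~` B k) x by exact: contrapT.
  exists k.+1%:R => _ [n _ <-]; rewrite leNgt; apply/negP => kf; apply: nBk.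
  exists n => //=; apply: ltW; apply: lt_le_trans kf _.
  by rewrite ler_piMr// indicE lern1 leq_b1.
have [||||Lg supg] := @Imu_mct f' (fun x => limn (f' ^~ x)) v.
- by move=> n; case: (f'E n).
- exact: ndf'.
- exact: cf'.
- by move=> n; rewrite (f'E n).2.
exists (fun x => limn (f' ^~ x)); first exact: Lg.
suff <- : (fun n => I (f' n)) = (fun n => I (f n)) by [].
by apply/funext => n; rewrite (f'E n).2.
Qed.

Lemma Imu_sub f g : L1p f -> L1p g ->
  ointegrable mu (fun x => f x - g x) /\ I (fun x => f x - g x) = I f - I g.
Proof.
move=> Lf Lg; pose h x := f x - g x.
have mh : borel_measurable h by apply: borel_measurableB; exact: L1p_measurable.
split; first by have := L1p_dist Lf Lg => /ointegrable_nonnegP[_ _].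
have hp0 x : 0 <= h^\+ x by rewrite /funrpos le_max lexx orbT.
have hn0 x : 0 <= h^\- x by rewrite /funrneg le_max lexx orbT.
have Lp : L1p h^\+.
  apply: (L1p_dom _ _ _ Lf) => //; first exact: borel_measurable_max mh (borel_measurable_cst 0).
  by move=> x; rewrite /funrpos ge_max gerBl (L1p_ge0 Lf) (L1p_ge0 Lg).
have Ln : L1p h^\-.
  apply: (L1p_dom _ _ _ Lg) => //.
    apply: borel_measurable_max (borel_measurable_cst 0).
    under eq_fun do rewrite opprB.
    by apply: borel_measurableB; exact: L1p_measurable.
  by move=> x; rewrite /funrneg ge_max opprB gerBl (L1p_ge0 Lf) (L1p_ge0 Lg).
have -> : I (fun x => f x - g x) = I h^\+ - I h^\- by rewrite [LHS]/Imu !Imu_nonneg.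
(* [h^\+ + g = f + h^\-] pointwise, so additivity on positive functions gives the claim. *)
apply/eqP; rewrite subr_eq addrAC eq_sym subr_eq eq_sym -!ImuD//.
apply/eqP; congr I; apply/funext => x; rewrite /funrpos /funrneg /h opprB.
by have [fg|gf] := lerP (f x - g x) 0; have [gf'|fg'] := lerP (g x - f x) 0; lra.
Qed.

End integrable_functions.

(** * Monotone limits *)

Section monotone_relation.
Context {R : realType}.
Implicit Types (a b c : R) (d : bool).

(* [true] stands for increasing and [false] for decreasing sequences. *)
Definition mle d a b := if d then a <= b else b <= a.

Definition mjoin d a b := if d then Num.max a b else Num.min a b.

Lemma mle_refl d a : mle d a a. Proof. by case: d => /=. Qed.

Lemma mle_trans d a b c : mle d a b -> mle d b c -> mle d a c.
Proof. by case: d => /= ab bc; [exact: le_trans bc|exact: le_trans ab]. Qed.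

Lemma mle_dist d a b c : mle d a b -> mle d b c -> `|c - b| <= `|c - a|.
Proof.
case: d => /= ab bc.
  by rewrite !ger0_norm ?subr_ge0// ?lerD2l ?lerN2//; exact: le_trans bc.
by rewrite !ler0_norm ?subr_le0// ?opprB ?lerD2r//; exact: le_trans ab.
Qed.

Lemma mle_joinl d a b : mle d a (mjoin d a b).
Proof. by case: d => /=; rewrite ?le_max ?ge_min lexx. Qed.

Lemma mle_joinr d a b : mle d b (mjoin d a b).
Proof. by case: d => /=; rewrite ?le_max ?ge_min lexx orbT. Qed.

Lemma mjoin_le d a b c : mle d a c -> mle d b c -> mle d (mjoin d a b) c.
Proof. by case: d => /= ac bc; rewrite ?ge_max ?le_min ac bc. Qed.

Fixpoint mjoins d (a : nat -> R) n :=
  if n is k.+1 then mjoin d (mjoins d a k) (a k.+1) else a 0%N.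

Lemma mjoins_ub d (a : nat -> R) i n : (i <= n)%N -> mle d (a i) (mjoins d a n).
Proof.
elim: n => [|n IH]; first by rewrite leqn0 => /eqP ->; exact: mle_refl.
rewrite leq_eqVlt => /predU1P[->|/IH]; first exact: mle_joinr.
by move=> /mle_trans; apply; exact: mle_joinl.
Qed.

Lemma mjoins_lub d (a : nat -> R) n c :
  (forall i, (i <= n)%N -> mle d (a i) c) -> mle d (mjoins d a n) c.
Proof.
elim: n => [|n IH] ac /=; first exact: ac.
by apply: mjoin_le; [apply: IH => i /leqW; exact: ac|exact: ac].
Qed.

Lemma mjoins_mono d (a : nat -> R) m n : (m <= n)%N ->
  mle d (mjoins d a m) (mjoins d a n).
Proof. by move=> mn; apply: mjoins_lub => i im; apply: mjoins_ub; exact: leq_trans mn. Qed.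

(** Needed for [mlim_op]: this estimate and its analogues for min and sums let convergence of
    integrals of distances pass through the operation. *)
Lemma max_dist_le a b a' b' :
  `|Num.max a b - Num.max a' b'| <= `|a - a'| + `|b - b'|.
Proof.
have := (ler_norm (a - a'), ler_norm (a' - a), ler_norm (b - b'), ler_norm (b' - b)).
rewrite (distrC a') (distrC b') => -[[[h1 h2] h3] h4].
rewrite ler_norml.
by case: (lerP a b) => ab; case: (lerP a' b') => ab'; apply/andP; split; lra.
Qed.

Lemma min_dist_le a b a' b' :
  `|Num.min a b - Num.min a' b'| <= `|a - a'| + `|b - b'|.
Proof.
have := (ler_norm (a - a'), ler_norm (a' - a), ler_norm (b - b'), ler_norm (b' - b)).
rewrite (distrC a') (distrC b') => -[[[h1 h2] h3] h4].
rewrite ler_norml.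
by case: (lerP a b) => ab; case: (lerP a' b') => ab'; apply/andP; split; lra.
Qed.

Lemma add_dist_le a b a' b' : `|(a + b) - (a' + b')| <= `|a - a'| + `|b - b'|.
Proof. by rewrite opprD addrACA; exact: ler_normD. Qed.

End monotone_relation.

Section null_sequences.
Context {R : realType} {E : povsType R}.
Implicit Types (a b : nat -> E).

Lemma infimums0_scale a (c : R) : 0 <= c -> infimums (range a) 0 ->
  infimums (range (fun n => c *: a n)) 0.
Proof.
move=> c0 /infimums_rangeP[a0 lb]; apply/infimums_rangeP; split=> [n|y ya].
  exact: povs_scale_ge0.
have [c00|cn0] := eqVneq c 0; first by have := ya 0%N; rewrite c00 scale0r.
have c1 : 0 < c by rewrite lt0r cn0.
rewrite -(scaler0 _ c) -(scale1r y) -(mulfV cn0) -scalerA.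
apply: povs_leZ => //.
by apply: lb => n; rewrite -(povs_leZE _ _ c1) scalerA mulfV// scale1r.
Qed.

(** By monotonicity [y <= a m + b k] for all [m] and [k]; the infimum over [m] and then over [k]
    gives [y <= 0]. *)
Lemma le0_of_le_add a b y : nonincreasing_seq a -> nonincreasing_seq b ->
  infimums (range a) 0 -> infimums (range b) 0 ->
  (forall n, y <= a n + b n) -> y <= 0.
Proof.
move=> nia nib /infimums_rangeP[a0 la] /infimums_rangeP[b0 lb] yab.
apply: lb => k; rewrite -(add0r (b k)) -povs_leBlDr; apply: la => m.
rewrite povs_leBlDr; apply: le_trans (yab (maxn m k)) _.
by apply: povs_leD; [apply: nia; exact: leq_maxl|apply: nib; exact: leq_maxr].
Qed.

End null_sequences.

Section monotone_limits_in_L1.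
Context {R : realType} {E : povsType R} {X : topologicalType}.
Variable mu : borel_set_measure E X.
Hypothesis mcE : monotone_complete E.
Local Notation L1p := (ointegrable_nonneg mu).
Local Notation I := (Imu mu).
Implicit Types (f g h : X -> R) (P : set (X -> R)) (d : bool).

(* Limits of increasing (resp. decreasing) sequences in [P]; the inequalities
   hold everywhere and only the convergence is up to null sets, expressed
   through the strict positivity of the integral. *)
Definition mlim d P : set (X -> R) := [set f | L1p f /\ exists u : nat -> X -> R,
  [/\ (forall n, P (u n)),
      (forall x m n, (m <= n)%N -> mle d (u m x) (u n x)),
      (forall n x, mle d (u n x) (f x)) &
      infimums (range (fun n => I (fun x => `|f x - u n x|))) 0]].

Lemma mlim_L1p d P : mlim d P `<=` L1p.
Proof. by move=> f []. Qed.

Lemma Imu_dist_up f g : L1p f -> L1p g -> (forall x, g x <= f x) ->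
  I (fun x => `|f x - g x|) = I f - I g.
Proof.
move=> Lf Lg gf; rewrite -ImuB//; congr I; apply/funext => x.
by rewrite ger0_norm// subr_ge0.
Qed.

Lemma Imu_dist_down f g : L1p f -> L1p g -> (forall x, f x <= g x) ->
  I (fun x => `|f x - g x|) = I g - I f.
Proof.
move=> Lf Lg fg; rewrite -Imu_dist_up//; congr I; apply/funext => x.
by rewrite distrC.
Qed.

Lemma mlim_upP P f : P `<=` L1p -> mlim true P f <-> L1p f /\
  exists u : nat -> X -> R,
  [/\ (forall n, P (u n)), (forall x, nondecreasing_seq (u ^~ x)),
      (forall n x, u n x <= f x) & supremums (range (fun n => I (u n))) (I f)].
Proof.
move=> PL; split=> -[Lf [u [Pu ndu uf lim]]]; (split; first exact: Lf);
  exists u; (split; [exact: Pu|by move=> x m n; exact: (ndu x m n)|exact: uf|]).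
- have := supremums_range_sub (I f) lim; rewrite subr0.
  suff <- : (fun n => I f - I (fun x => `|f x - u n x|)) = (fun n => I (u n)) by [].
  apply/funext => n; rewrite Imu_dist_up ?subKr//; first exact: PL.
  exact: (uf n).
- have := infimums_range_sub (I f) lim; rewrite subrr.
  suff <- : (fun n => I f - I (u n)) = (fun n => I (fun x => `|f x - u n x|)) by [].
  by apply/funext => n; rewrite Imu_dist_up//; exact: PL.
Qed.

Lemma mlim_downP P f : P `<=` L1p -> mlim false P f <-> L1p f /\
  exists u : nat -> X -> R,
  [/\ (forall n, P (u n)), (forall x, nonincreasing_seq (u ^~ x)),
      (forall n x, f x <= u n x) & infimums (range (fun n => I (u n))) (I f)].
Proof.
have shift (a : nat -> E) v w : infimums (range a) v ->
    infimums (range (fun n => a n - w)) (v - w).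
  move=> /infimums_rangeP[va lb]; apply/infimums_rangeP; split=> [n|y yw].
    exact: povs_leD2r.
  by rewrite povs_leBrDr; apply: lb => n; rewrite -povs_leBrDr.
move=> PL; split=> -[Lf [u [Pu ndu uf lim]]]; (split; first exact: Lf);
  exists u; (split; [exact: Pu|by move=> x m n; exact: (ndu x m n)|exact: uf|]).
- have := shift _ _ (- I f) lim; rewrite opprK add0r.
  suff <- : (fun n => I (fun x => `|f x - u n x|) + I f) = (fun n => I (u n)) by [].
  apply/funext => n; rewrite Imu_dist_down ?subrK//; first exact: PL.
  exact: (uf n).
- have := shift _ _ (I f) lim; rewrite subrr.
  suff <- : (fun n => I (u n) - I f) = (fun n => I (fun x => `|f x - u n x|)) by [].
  by apply/funext => n; rewrite Imu_dist_down//; exact: PL.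
Qed.

(** Sums and positive multiples build simple functions from indicators; max and min turn countable
    families into monotone sequences. *)
Definition cone_lattice P := [/\ P `<=` L1p,
  (forall f g, P f -> P g -> P (fun x => f x + g x)),
  (forall (c : R) f, 0 <= c -> P f -> P (fun x => c * f x)),
  (forall f g, P f -> P g -> P (fun x => Num.max (f x) (g x))) &
  (forall f g, P f -> P g -> P (fun x => Num.min (f x) (g x)))].

Lemma sub_mlim d P : P `<=` L1p -> P `<=` mlim d P.
Proof.
move=> PL f Pf; split; first exact: PL.
exists (fun _ => f); split=> //; [by move=> *; exact: mle_refl..|].
under [X in range X]eq_fun do under [X in I X]eq_fun do rewrite subrr normr0.
by apply/infimums_rangeP; rewrite Imu0//; split=> // y; apply; exact: 0%N.
Qed.

Lemma Imu_dist_nonincreasing d f (u : nat -> X -> R) : L1p f ->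
  (forall n, L1p (u n)) ->
  (forall x m n, (m <= n)%N -> mle d (u m x) (u n x)) ->
  (forall n x, mle d (u n x) (f x)) ->
  nonincreasing_seq (fun n => I (fun x => `|f x - u n x|)).
Proof.
move=> Lf Lu ndu uf m n mn; apply: Imu_le => //; [exact: L1p_dist..|].
by move=> x; apply: (@mle_dist _ d) => //; exact: ndu.
Qed.

(** One argument serves sums, maxima and minima. Monotonicity of [op] keeps the sequence on its side
    of the limit, and the estimate on distances carries the convergence over. *)
Lemma mlim_op d P (op : R -> R -> R) : P `<=` L1p ->
  (forall f g, L1p f -> L1p g -> L1p (fun x => op (f x) (g x))) ->
  (forall f g, P f -> P g -> P (fun x => op (f x) (g x))) ->
  (forall a b a' b', mle d a a' -> mle d b b' -> mle d (op a b) (op a' b')) ->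
  (forall a b a' b', `|op a b - op a' b'| <= `|a - a'| + `|b - b'|) ->
  forall f g, mlim d P f -> mlim d P g -> mlim d P (fun x => op (f x) (g x)).
Proof.
move=> PL Lop Pop mop opd f g [Lf [u [Pu mu_ uf limu]]] [Lg [v [Pv mv vg limv]]].
split; first exact: Lop.
have Lu n : L1p (u n) by exact: PL.
have Lv n : L1p (v n) by exact: PL.
exists (fun n x => op (u n x) (v n x)); split.
- by move=> n; exact: Pop.
- by move=> x m n mn; apply: mop; [exact: mu_|exact: mv].
- by move=> n x; exact: mop.
- apply/infimums_rangeP; split=> [n|y yfg].
    by apply: Imu_ge0 => //; apply: L1p_dist => //; exact: Lop.
  apply: (le0_of_le_add _ _ limu limv).
  + exact: Imu_dist_nonincreasing uf.
  + exact: Imu_dist_nonincreasing vg.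
  + move=> n; apply: le_trans (yfg n) _.
    rewrite -ImuD//; [|exact: L1p_dist..].
    apply: Imu_le => //; first by apply: L1p_dist => //; exact: Lop.
    by apply: L1pD => //; exact: L1p_dist.
Qed.

Lemma mlim_scale d P (c : R) : 0 <= c -> P `<=` L1p ->
  (forall f, P f -> P (fun x => c * f x)) ->
  forall f, mlim d P f -> mlim d P (fun x => c * f x).
Proof.
move=> c0 PL Pc f [Lf [u [Pu mu_ uf limu]]]; split; first exact: L1pZ.
have mlec a b : mle d a b -> mle d (c * a) (c * b).
  by case: (d) => /= ab; exact: ler_wpM2l.
exists (fun n x => c * u n x); split.
- by move=> n; exact: Pc.
- by move=> x m n mn; apply: mlec; exact: mu_.
- by move=> n x; exact: mlec.
- have := infimums0_scale c0 limu.
  suff -> : (fun n => c *: I (fun x => `|f x - u n x|)) =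
      (fun n => I (fun x => `|c * f x - c * u n x|)) by [].
  apply/funext => n; rewrite -ImuZ//; last by apply: L1p_dist => //; exact: PL.
  congr I; apply/funext => x; rewrite -mulrBr normrM ger0_norm//.
Qed.

Lemma mlim_cone_lattice d P : cone_lattice P -> cone_lattice (mlim d P).
Proof.
move=> [PL PD PZ Pmax Pmin]; split.
- exact: mlim_L1p.
- apply: mlim_op => //; [exact: L1pD| |exact: add_dist_le].
  by case: d => a b a' b' /= *; exact: lerD.
- by move=> c f c0; apply: mlim_scale => // h; exact: PZ.
- apply: mlim_op => //; [exact: L1p_max| |exact: max_dist_le].
  case: d => a b a' b' /= ab ab'.
    by rewrite ge_max !le_max ab ab' orbT.
  by rewrite ge_max !le_max ab ab' orbT.
- apply: mlim_op => //; [exact: L1p_min| |exact: min_dist_le].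
  case: d => a b a' b' /= ab ab'.
    by rewrite le_min !ge_min ab ab' orbT.
  by rewrite le_min !ge_min ab ab' orbT.
Qed.

(** A diagonal argument: [g n] joins [U 0 n], ..., [U n n]. For [m = maxn i n], [g m] is at least as
    close to [f] as [U i n] is, so its distance from [f] is at most that from [f] to [F i] plus that
    from [F i] to [U i n]. The infimum of the integrals over [n] and then over [i] is [0]. *)
Lemma mlim_idem d P : cone_lattice P -> mlim d (mlim d P) `<=` mlim d P.
Proof.
move=> [PL PD PZ Pmax Pmin] f [Lf [F [PF mF Ff limF]]]; split=> //.
have Pjoin g h : P g -> P h -> P (fun x => mjoin d (g x) (h x)).
  by case: (d) => /=; [exact: Pmax|exact: Pmin].
have [U UP] := choice (fun i => (PF i).2).
have LF i : L1p (F i) := (PF i).1.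
have LU i n : L1p (U i n) by apply: PL; case: (UP i).
have mU i x m n : (m <= n)%N -> mle d (U i m x) (U i n x) by case: (UP i) => _ + _ _; exact.
have UF i n x : mle d (U i n x) (F i x) by case: (UP i).
pose g n x := mjoins d (fun i => U i n x) n.
have Pg n : P (g n).
  suff : forall k, P (fun x => mjoins d (fun i => U i n x) k) by exact.
  elim=> [|k IH] /=; first by case: (UP 0%N).
  by apply: Pjoin => //; case: (UP k.+1).
have gf n x : mle d (g n x) (f x).
  by apply: mjoins_lub => i _; exact: mle_trans (UF i n x) (Ff i x).
exists g; split; [exact: Pg| |exact: gf|].
  move=> x m n mn; apply: mjoins_lub => i im; apply: mle_trans (mU i x _ _ mn) _.
  exact: (mjoins_ub d (fun i => U i n x) (leq_trans im mn)).
apply/infimums_rangeP; split=> [n|y yg].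
  by apply: Imu_ge0 => //; apply: L1p_dist => //; exact: PL.
have [_ lbF] := (infimums_rangeP _ _).1 limF; apply: lbF => i.
rewrite -(add0r (I _)) -povs_leBlDr.
have [_ _ _ /infimums_rangeP[_ lbU]] := UP i; apply: lbU => n.
rewrite povs_leBlDr; apply: le_trans (yg (maxn i n)) _.
rewrite -ImuD//; [|exact: L1p_dist..].
apply: Imu_le => //.
- by apply: L1p_dist => //; exact: PL.
- by apply: L1pD => //; exact: L1p_dist.
move=> x; apply: (@le_trans _ _ `|f x - U i n x|).
  apply: (@mle_dist _ d) => //; apply: mle_trans (mU i x _ _ (leq_maxr i n)) _.
  exact: (mjoins_ub d (fun j => U j (maxn i n) x) (leq_maxl i n)).
by rewrite [leRHS]addrC; apply: le_trans (ler_normD _ _); rewrite addrA subrK.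
Qed.

Lemma Imu_mlim_up P : P `<=` L1p -> I @` mlim true P `<=` seq_up (I @` P).
Proof.
move=> PL _ [f /(mlim_upP _ PL)[Lf [u [Pu ndu uf supu]]] <-].
exists (fun n => I (u n)); split.
- by move=> m n mn; apply: Imu_le => [|||x] //; [exact: PL|exact: PL|exact: ndu].
- by move=> n; exists (u n).
- by rewrite supremums_inT.
Qed.

Lemma Imu_mlim_down P : P `<=` L1p -> I @` mlim false P `<=` seq_down (I @` P).
Proof.
move=> PL _ [f /(mlim_downP _ PL)[Lf [u [Pu ndu uf supu]]] <-].
exists (fun n => I (u n)); split.
- by move=> m n mn; apply: Imu_le => [|||x] //; [exact: PL|exact: PL|exact: ndu].
- by move=> n; exists (u n).
- by rewrite infimums_inT.
Qed.

End monotone_limits_in_L1.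

(** * Preservation of moduli and closure under monotone limits *)

Section moduli.
Context {R : realType} {E : povsType R} {X : topologicalType}.
Variable mu : borel_set_measure E X.
Hypothesis mcE : monotone_complete E.
Hypothesis Imu_mod : preserves_moduli_on (ointegrable mu) (Imu mu).
Local Notation L1p := (ointegrable_nonneg mu).
Local Notation I := (Imu mu).
Implicit Types (f g h : X -> R) (v w : E).

(* From [2 max(f, g) = f + g + |f - g|], since the integral preserves moduli. *)
Lemma Imu_max_le f g v : L1p f -> L1p g -> I f <= v -> I g <= v ->
  I (fun x => Num.max (f x) (g x)) <= v.
Proof.
move=> Lf Lg fv gv; pose h x := f x - g x.
have [Dh Ih] := Imu_sub mcE Lf Lg.
have La := L1p_dist mcE Lf Lg.
(* The modulus of [h] in the space of integrable functions is the pointwise absolute value, so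
   [Imu_mod] applies to it. *)
have absh : supremums_in (ointegrable mu) [set (h : X -> R); - (h : X -> R)]
    (fun x => `|h x|).
  split; first split; first exact: La.1.
    by move=> _ [->|->]; apply/lefP => x /=; [exact: ler_norm|rewrite -normrN ler_norm].
  move=> k [_ kub]; apply/lefP => x; rewrite ler_norml.
  have /lefP/(_ x) hk := kub h (or_introl erefl).
  have /lefP/(_ x) /= nhk := kub (- h) (or_intror erefl).
  by rewrite hk andbT lerNl.
have [_ lb] := Imu_mod Dh absh.
have Lm := L1p_max mcE Lf Lg.
have maxE : I (fun x => `|h x|) =
    2 *: I (fun x => Num.max (f x) (g x)) - (I f + I g).
  apply/eqP; rewrite eq_sym subr_eq -ImuZ// -!ImuD//; last exact: L1pD.
  apply/eqP; congr I; apply/funext => x; rewrite /h.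
  by case: (lerP (f x) (g x)) => _; ring.
(* The right-hand side is an upper bound of both [I h] and [- I h], hence of their supremum, the
   integral of [|h|]. *)
have le2 : I (fun x => `|h x|) <= 2 *: v - (I f + I g).
  rewrite scaler_nat mulr2n.
  have le2 (a b : E) : a <= v -> a - b <= v + v - (a + b).
    by move=> av; rewrite povs_leBrDr [a + b]addrC addrA subrK; exact: povs_leD.
  apply: lb => _ [->|->]; rewrite Ih; first exact: le2.
  by rewrite (opprB (I f) (I g)) [I f + I g]addrC; exact: le2.
by move: le2; rewrite maxE povs_leD2rE povs_leZE.
Qed.

(** Minimum and maximum add up to [f + g], which reduces this to [Imu_max_le] with the bound
    [I f + I g - v]. *)
Lemma Imu_min_ge f g v : L1p f -> L1p g -> v <= I f -> v <= I g ->
  v <= I (fun x => Num.min (f x) (g x)).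
Proof.
move=> Lf Lg vf vg.
have -> : I (fun x => Num.min (f x) (g x)) =
    I f + I g - I (fun x => Num.max (f x) (g x)).
  apply/eqP; rewrite eq_sym subr_eq -!ImuD//; [|exact: L1p_min|exact: L1p_max].
  by apply/eqP; congr I; apply/funext => x; rewrite addr_min_max.
rewrite povs_leBrDr addrC -povs_leBrDr; apply: Imu_max_le => //.
  by rewrite povs_leBrDr povs_leD2lE.
by rewrite povs_leBrDr addrC povs_leD2rE.
Qed.

Lemma L1p_mjoins d (f : nat -> X -> R) n : (forall i, L1p (f i)) ->
  L1p (fun x => mjoins d (f ^~ x) n).
Proof.
move=> Lf; elim: n => [|n IH] //=.
by case: d IH => IH; [exact: L1p_max|exact: L1p_min].
Qed.

Lemma Imu_mjoins_max (f : nat -> X -> R) v n : (forall i, L1p (f i)) ->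
  (forall i, I (f i) <= v) -> I (fun x => mjoins true (f ^~ x) n) <= v.
Proof.
move=> Lf fv; elim: n => [|n IH] /=; first exact: fv.
by apply: Imu_max_le => //; exact: (L1p_mjoins true).
Qed.

Lemma Imu_mjoins_min (f : nat -> X -> R) v n : (forall i, L1p (f i)) ->
  (forall i, v <= I (f i)) -> v <= I (fun x => mjoins false (f ^~ x) n).
Proof.
move=> Lf fv; elim: n => [|n IH] /=; first exact: fv.
by apply: Imu_min_ge => //; exact: (L1p_mjoins false).
Qed.

(** Neither the [u n] nor functions representing them need be monotone. Their finite maxima
    increase, and [Imu_max_le] keeps the integrals of these below [v], so [L1p_sup_seq] provides a
    function whose integral is at most [v] and at least every [u n]. *)
Lemma Imu_L1p_sup_seq (u : nat -> E) v : (forall n, (I @` L1p) (u n)) ->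
  supremums (range u) v -> (I @` L1p) v.
Proof.
move=> Su uv; have [ub lb] := (supremums_rangeP _ _).1 uv.
have /choice[f fP] n : exists f, L1p f /\ I f = u n.
  by have [f Lf <-] := Su n; exists f.
have Lf n : L1p (f n) := (fP n).1.
have fE n : I (f n) = u n := (fP n).2.
pose g n x := mjoins true (f ^~ x) n.
have Lg n : L1p (g n) by exact: L1p_mjoins.
have Ig n : I (g n) <= v by apply: Imu_mjoins_max => // i; rewrite fE.
have ndg x : nondecreasing_seq (g ^~ x).
  by move=> m n mn; exact: (mjoins_mono true).
have [h Lh hsup] := L1p_sup_seq mcE Lg ndg Ig; exists h => //.
apply: supremums_unique hsup _; apply/supremums_rangeP; split=> // y gy.
apply: lb => n; rewrite -fE; apply: le_trans (gy n); apply: Imu_le => // x.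
exact: (mjoins_ub true (f ^~ x) (leqnn n)).
Qed.

Lemma Imu_L1p_inf_seq (u : nat -> E) v : (forall n, (I @` L1p) (u n)) ->
  infimums (range u) v -> (I @` L1p) v.
Proof.
move=> Su uv; have [ub lb] := (infimums_rangeP _ _).1 uv.
have /choice[f fP] n : exists f, L1p f /\ I f = u n.
  by have [f Lf <-] := Su n; exists f.
have Lf n : L1p (f n) := (fP n).1.
have fE n : I (f n) = u n := (fP n).2.
pose g n x := mjoins false (f ^~ x) n.
have Lg n : L1p (g n) by exact: L1p_mjoins.
have Ig n : v <= I (g n) by apply: Imu_mjoins_min => // i; rewrite fE.
have nig x : nonincreasing_seq (g ^~ x).
  by move=> m n mn; exact: (mjoins_mono false).
(* Positive functions decrease to a finite limit, so no null set has to be removed here. *)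
have cg x : g ^~ x @ \oo --> limn (g ^~ x).
  apply: nonincreasing_is_cvgn => //.
  by exists 0 => _ [n _ <-]; exact: L1p_ge0.
have [Lh hinf] := Imu_mct_decreasing mcE Lg nig cg.
exists (fun x => limn (g ^~ x)) => //.
apply: infimums_unique hinf _; apply/infimums_rangeP; split=> // y gy.
apply: lb => n; rewrite -fE; apply: le_trans (gy n) _; apply: Imu_le => // x.
exact: (mjoins_ub false (f ^~ x) (leqnn n)).
Qed.

Hypothesis cspE : countable_sup_property E.

Lemma sub_net_up (S : set E) : S `<=` net_up S.
Proof.
move=> v Sv; exists unit, (fun _ _ => True), (fun _ => v).
have dir : directed (fun _ _ : unit => True) by split=> //; exists tt.
split=> //.
by rewrite supremums_inT; apply/supremums_rangeP; split=> // y; apply; exact: tt.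
Qed.

Lemma sub_net_down (S : set E) : S `<=` net_down S.
Proof.
move=> v Sv; exists unit, (fun _ _ => True), (fun _ => v).
have dir : directed (fun _ _ : unit => True) by split=> //; exists tt.
split=> //.
by rewrite infimums_inT; apply/infimums_rangeP; split=> // y; apply; exact: tt.
Qed.

Lemma net_up_Imu_L1p : net_up (I @` L1p) = I @` L1p.
Proof.
apply/seteqP; split; last exact: sub_net_up.
move=> v [J [leJ [u [incu Su]]]]; rewrite supremums_inT => uv.
have [l lv] := countable_sup_propertyT cspE incu uv.
by apply: Imu_L1p_sup_seq lv => n; exact: Su.
Qed.

Lemma net_down_Imu_L1p : net_down (I @` L1p) = I @` L1p.
Proof.
apply/seteqP; split; last exact: sub_net_down.
move=> v [J [leJ [u [decu Su]]]]; rewrite infimums_inT => uv.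
have [l lv] := countable_inf_property cspE decu uv.
by apply: Imu_L1p_inf_seq lv => n; exact: Su.
Qed.

Lemma seq_up_Imu_L1p (S : set E) : S `<=` I @` L1p -> seq_up S `<=` I @` L1p.
Proof.
by move=> SL v /(seq_up_in_sub SL)/seq_up_net_up; rewrite net_up_Imu_L1p.
Qed.

Lemma seq_down_Imu_L1p (S : set E) : S `<=` I @` L1p -> seq_down S `<=` I @` L1p.
Proof.
by move=> SL v /(seq_down_in_sub SL)/seq_down_net_down; rewrite net_down_Imu_L1p.
Qed.

End moduli.

(** * Classes modulo null sets *)

Section classes_theory.
Context {R : realType} {E : povsType R} {X : topologicalType}.
Variable mu : borel_set_measure E X.
Hypothesis mcE : monotone_complete E.
Local Notation L1p := (ointegrable_nonneg mu).
Local Notation I := (Imu mu).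
Local Open Scope quotient_scope.
Implicit Types (f g h : bmfun R X) (P : set (X -> R)).

Lemma bmfun_measurable f : borel_measurable f.
Proof. by case: f => f mf; exact/asboolP. Qed.

Lemma bmfunP (f : X -> R) : borel_measurable f -> exists g : bmfun R X, g = f :> (X -> R).
Proof. by move=> /asboolP mf; exists (Bmfun mf). Qed.

Lemma repr_ae f : oae mu (fun x => repr (\pi_(L0 mu) f) x = f x).
Proof.
by have /eqmodP/asboolP : \pi_(L0 mu) (repr (\pi_(L0 mu) f)) = \pi_(L0 mu) f
  by rewrite reprK.
Qed.

Lemma L0_leP f g :
  (\pi_(L0 mu) f <= \pi_(L0 mu) g) <-> oae mu (fun x => f x <= g x).
Proof.
split=> [/asboolP le|le].
  have := aeI (fun x H1 H2 => conj H1 H2) (repr_ae f) (repr_ae g).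
  by move=> /(aeI _ le); apply=> x + [e1 e2]; rewrite e1 e2.
apply/asboolP.
have := aeI (fun x H1 H2 => conj H1 H2) (repr_ae f) (repr_ae g).
by move=> /(aeI _ le); apply=> x + [e1 e2]; rewrite e1 e2.
Qed.

Lemma L1_reprP (q : L0 mu) : L1 mu q -> exists2 k, q = \pi_(L0 mu) k & ointegrable mu k.
Proof. by case=> k Dk <-; exists k. Qed.

Lemma L1p_pos_part (k : X -> R) : ointegrable mu k -> L1p (fun x => Num.max (k x) 0).
Proof.
move=> [mk fink]; have La : L1p (fun x => `|k x|).
  by apply/ointegrable_nonnegP; split=> //; exact: borel_measurable_norm.
apply: (L1p_dom mcE _ _ _ La) => [|x|x].
- exact: borel_measurable_max mk (borel_measurable_cst 0).
- by rewrite le_max lexx orbT.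
- by rewrite ge_max ler_norm normr_ge0.
Qed.

Lemma Imu_eq_le (f g : X -> R) : L1p f -> L1p g -> (forall x, f x <= g x) ->
  I g <= I f -> oae mu (fun x => f x = g x).
Proof.
move=> Lf Lg fg gf; have := Imu_eq0 mcE (L1pB mcE Lg Lf fg).
rewrite ImuB// => /(_ _) ae0; have {}ae0 : oae mu (fun x => g x - f x = 0).
  apply: ae0; apply/eqP; rewrite subr_eq0 eq_le gf/=.
  exact: Imu_le.
by apply: (aeI _ ae0 ae0) => x /eqP; rewrite subr_eq0 => /eqP ->.
Qed.

(** Let [k] be an integrable upper bound of the [u n] almost everywhere. The minimum of [f] and the
    positive part of [k] is still above every [u n], so its integral is at least [I f], and strict
    positivity makes it equal to [f]. As [0 <= u 0 <= k], the positive part of [k] is [k] itself,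
    all this almost everywhere. *)
Lemma aeclasses_mlim_up P : P `<=` L1p ->
  aeclasses mu (mlim mu true P) `<=` seq_up_in (L1 mu) (aeclasses mu P).
Proof.
move=> PL _ [f /(mlim_upP mcE _ PL)[Lf [u [Pu ndu uf supu]]] <-].
have [v vE] := choice (fun n => bmfunP (L1p_measurable (PL _ (Pu n)))).
exists (fun n => \pi_(L0 mu) (v n)); split.
- by move=> m n mn; apply/L0_leP/aeT => x; rewrite !vE; exact: ndu.
- by move=> n; exists (v n) => //=; rewrite vE.
have [_ lb] := (supremums_rangeP _ _).1 supu.
split; first split.
- by exists f => //; exact: Lf.1.
- by move=> _ [n _ <-]; apply/L0_leP/aeT => x; rewrite vE.
move=> q [/L1_reprP[k -> Dk] kub].
have uk n : oae mu (fun x => u n x <= k x).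
  have /L0_leP : \pi_(L0 mu) (v n) <= \pi_(L0 mu) k by apply: kub; exists n.
  by rewrite vE.
have Lk := L1p_pos_part Dk; have Lm := L1p_min mcE Lf Lk.
apply/L0_leP.
have fm : oae mu (fun x => Num.min (f x) (Num.max (k x) 0) = f x).
  apply: Imu_eq_le => //; first by move=> x; rewrite ge_min lexx.
  apply: lb => n; apply: Imu_le_ae => //; first exact: PL.
  by apply: (aeI _ (uk n) (uk n)) => x ukx _; rewrite le_min uf le_max ukx.
apply: (aeI _ fm (uk 0%N)) => x <- u0k.
rewrite (max_idPl _) ?ge_min ?lexx ?orbT//.
by apply: le_trans u0k; apply: L1p_ge0; exact: PL (Pu _).
Qed.

(** Dually, the maximum of [f] and the positive part of a lower bound [k] has integral at most
    [I f], hence equals [f] almost everywhere. *)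
Lemma aeclasses_mlim_down P : P `<=` L1p ->
  aeclasses mu (mlim mu false P) `<=` seq_down_in (L1 mu) (aeclasses mu P).
Proof.
move=> PL _ [f /(mlim_downP mcE _ PL)[Lf [u [Pu ndu uf infu]]] <-].
have [v vE] := choice (fun n => bmfunP (L1p_measurable (PL _ (Pu n)))).
exists (fun n => \pi_(L0 mu) (v n)); split.
- by move=> m n mn; apply/L0_leP/aeT => x; rewrite !vE; exact: ndu.
- by move=> n; exists (v n) => //=; rewrite vE.
have [_ lb] := (infimums_rangeP _ _).1 infu.
split; first split.
- by exists f => //; exact: Lf.1.
- by move=> _ [n _ <-]; apply/L0_leP/aeT => x; rewrite vE.
move=> q [/L1_reprP[k -> Dk] kub].
have uk n : oae mu (fun x => k x <= u n x).
  have /L0_leP : \pi_(L0 mu) k <= \pi_(L0 mu) (v n) by apply: kub; exists n.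
  by rewrite vE.
have Lk := L1p_pos_part Dk; have Lm := L1p_max mcE Lf Lk.
apply/L0_leP.
have fm : oae mu (fun x => f x = Num.max (f x) (Num.max (k x) 0)).
  apply: Imu_eq_le => //; first by move=> x; rewrite le_max lexx.
  apply: lb => n; apply: Imu_le_ae => //; first exact: PL.
  apply: (aeI _ (uk n) (uk n)) => x ukx _; rewrite !ge_max uf ukx/=.
  by apply: L1p_ge0; exact: PL (Pu _).
by apply: (aeI _ fm fm) => x -> _; rewrite !le_max lexx orbT.
Qed.

(** The representative picked by [repr] may be negative on a null set, so its positive and negative
    parts are compared with [f] and [0] separately. *)
Lemma IL1_class f : L1p f -> IL1 mu (\pi_(L0 mu) f) = I f.
Proof.
move=> Lf; rewrite /IL1; set h := repr _; have hf := repr_ae f : oae mu (fun x => h x = f x).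
have mh := bmfun_measurable h.
have hp : oae mu (fun x => f x = h^\+ x).
  by apply: (aeI _ hf hf) => x hx _; rewrite /funrpos hx (max_idPl _)//; exact: (L1p_ge0 Lf).
have hn : oae mu (fun x => 0 = h^\- x).
  apply: (aeI _ hf hf) => x hx _; rewrite /funrneg hx (max_idPr _)//.
  by rewrite oppr_le0; exact: (L1p_ge0 Lf).
have [|_ <-] := Imu_ae mcE Lf (borel_measurable_max mh (borel_measurable_cst 0)) _ hp.
  by move=> x; rewrite le_max lexx orbT.
have mn : borel_measurable h^\-.
  apply: borel_measurable_max (borel_measurable_cst 0).
  have := borel_measurableB (borel_measurable_cst 0) mh.
  by under eq_fun do rewrite sub0r.
have n0 x : 0 <= h^\- x by rewrite /funrneg le_max lexx orbT.
have [_ In] := Imu_ae mcE (L1p0 mu mcE) mn n0 hn.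
rewrite [LHS]/Imu (Imu_nonneg mu mcE (f := h^\+)); last first.
  by move=> x; rewrite /funrpos le_max lexx orbT.
rewrite -[X in _ - X](Imu_nonneg mu mcE (f := h^\-))// In Imu0// subr0.
by [].
Qed.

(** A class above zero contains the absolute value of its representative [k], which is positive
    everywhere. *)
Lemma IL1_nonneg (q : L0 mu) (z : bmfun R X) : (forall x, z x = 0) ->
  L1 mu q -> \pi_(L0 mu) z <= q -> (I @` L1p) (IL1 mu q).
Proof.
move=> z0 /L1_reprP[k -> [mk fink]] /L0_leP zk.
have La : L1p (fun x => `|k x|).
  by apply/ointegrable_nonnegP; split=> //; exact: borel_measurable_norm.
have [a aE] := bmfunP (L1p_measurable La).
suff -> : \pi_(L0 mu) k = \pi_(L0 mu) a.
  by rewrite IL1_class ?aE//; exists (fun x => `|k x|).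
apply/eqmodP/asboolP; apply: (aeI _ zk zk) => x; rewrite z0 aE => k0 _.
by rewrite ger0_norm.
Qed.

End classes_theory.

Section lower_bounds.
Context {d : Order.disp_t} {T : porderType d}.
Implicit Types (D S : set T).

Lemma seq_up_in_bounded D S z : S `<=` [set q | D q /\ (z <= q)%O] ->
  seq_up_in D S `<=` [set q | D q /\ (z <= q)%O].
Proof.
move=> SD q [u [_ Su [[Dq ubq] _]]]; split=> //.
by apply: le_trans (SD _ (Su 0%N)).2 _; apply: ubq; exists 0%N.
Qed.

(** [z] itself competes with the infimum as a lower bound, so it has to belong to [D]. *)
Lemma seq_down_in_bounded D S z : D z -> S `<=` [set q | D q /\ (z <= q)%O] ->
  seq_down_in D S `<=` [set q | D q /\ (z <= q)%O].
Proof.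
move=> Dz SD q [u [_ Su [[Dq lbq] ubq]]]; split=> //.
by apply: ubq; split=> // _ [n _ <-]; exact: (SD _ (Su n)).2.
Qed.

End lower_bounds.

(** * Approximation by compactly supported functions *)

Section compactly_supported.
Context {R : realType} {X : topologicalType}.
Implicit Types (f g h : X -> R).

Definition Ccp : set (X -> R) := [set f | is_Cc f /\ forall x, 0 <= f x].

Lemma CcpE : [set (f : X -> R) | f in Cc_nonneg R X] = Ccp.
Proof.
apply/seteqP; split=> [_ [f f0 <-]|f [Cf f0]].
  by split=> //; case: f {f0} => f pf; exact/asboolP.
have pf : f \in Cc_pred by apply/asboolP.
by exists (CcType pf).
Qed.

Lemma is_Cc_vanishing f g h : continuous h -> is_Cc f -> is_Cc g ->
  (forall x, f x = 0 -> g x = 0 -> h x = 0) ->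
  is_Cc h /\ supp h `<=` supp f `|` supp g.
Proof.
move=> ch [_ kf] [_ kg] h0.
have sub : supp h `<=` supp f `|` supp g.
  rewrite /supp -closureU; apply: closure_subset => x /=; apply: contraPP.
  by move=> /not_orP[/negP + /negP]; rewrite !negbK => /eqP f0 /eqP g0; apply/negP;
    rewrite negbK h0.
split=> //; split=> //.
apply: (@subclosed_compact _ _ (supp f `|` supp g)) => //; first exact: closed_closure.
exact: compactU.
Qed.

Lemma is_Cc_max f g : is_Cc f -> is_Cc g -> is_Cc (fun x => Num.max (f x) (g x)) /\
  supp (fun x => Num.max (f x) (g x)) `<=` supp f `|` supp g.
Proof.
move=> Cf Cg; apply: is_Cc_vanishing => // [x|x -> ->]; last by rewrite maxxx.
by apply: continuous_max; [exact: Cf.1|exact: Cg.1].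
Qed.

Lemma is_Cc_min f g : is_Cc f -> is_Cc g -> is_Cc (fun x => Num.min (f x) (g x)) /\
  supp (fun x => Num.min (f x) (g x)) `<=` supp f `|` supp g.
Proof.
move=> Cf Cg; apply: is_Cc_vanishing => // [x|x -> ->]; last by rewrite minxx.
by apply: continuous_min; [exact: Cf.1|exact: Cg.1].
Qed.

Lemma is_Cc0 : is_Cc (fun _ : X => 0 : R).
Proof. by have /asboolP := (Cc_submod_closed (R := R) (X := X)).1. Qed.

Lemma is_CcD f g : is_Cc f -> is_Cc g -> is_Cc (fun x => f x + g x).
Proof.
move=> Cf Cg; apply: (proj1 (is_Cc_vanishing _ Cf Cg _)) => [x|x -> ->].
  by apply: cvgD; [exact: Cf.1|exact: Cg.1].
by rewrite addr0.
Qed.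

Lemma is_CcZ (c : R) f : is_Cc f -> is_Cc (fun x => c * f x).
Proof.
move=> Cf; apply: (proj1 (is_Cc_vanishing _ Cf Cf _)) => [x|x -> _].
  by apply: cvgMr; exact: Cf.1.
by rewrite mulr0.
Qed.

Lemma supp0 : supp (fun _ : X => 0 : R) = set0.
Proof.
rewrite /supp (_ : [set _ | _] = set0) ?closure0//.
by apply/seteqP; split=> x //=; rewrite eqxx.
Qed.

Lemma notin_supp f x : ~ supp f x -> f x = 0.
Proof.
by move=> sfx; apply/eqP; apply: contrapT => /negP fx; apply: sfx; exact: subset_closure.
Qed.

End compactly_supported.
Arguments Ccp R X : clear implicits.

Section approximation.
Context {R : realType} {E : povsType R} {X : topologicalType}.
Variables (pi : {linear Cc R X -> E}) (mu : borel_set_measure E X).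
Hypothesis hausX : hausdorff_space X.
Hypothesis mcE : monotone_complete E.
Hypothesis cspE : countable_sup_property E.
Hypothesis mu_reg : regular_borel_measure mu.
Hypothesis pi_int : forall f : Cc R X, ointegrable mu f /\ pi f = Imu mu f.
Hypothesis mu_open : forall (V : set X) (v : E), open V -> mu V = Fin v ->
  supremums_in (poscone E) [set pi f | f in [set f | prec_open f V]] v.
Hypothesis mu_compact : forall (K : set X) (k : E), compact K -> mu K = Fin k ->
  infimums_in (poscone E) [set pi f | f in [set f | prec_compact K f]] k.
Local Notation L1p := (ointegrable_nonneg mu).
Local Notation I := (Imu mu).
Local Notation C0 := (Ccp R X).
Implicit Types (f g h : X -> R) (A B K V : set X).

Lemma Cc_is_Cc (f : Cc R X) : is_Cc f.
Proof. by case: f => f pf; exact/asboolP. Qed.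

Lemma Ccp_L1p : C0 `<=` L1p.
Proof.
move=> f [Cf f0]; have pf : f \in Cc_pred by apply/asboolP.
by split=> //; have [] := pi_int (CcType pf).
Qed.

Lemma pi_Ccp : pi @` Cc_nonneg R X = I @` C0.
Proof.
rewrite -CcpE image_comp; congr image; apply/funext => f /=.
exact: (pi_int f).2.
Qed.

Lemma Ccp_cone_lattice : cone_lattice mu C0.
Proof.
split; first exact: Ccp_L1p.
- by move=> f g [Cf f0] [Cg g0]; split=> [|x]; [exact: is_CcD|exact: addr_ge0].
- by move=> c f c0 [Cf f0]; split=> [|x]; [exact: is_CcZ|exact: mulr_ge0].
- move=> f g [Cf f0] [Cg g0]; split=> [|x]; last by rewrite le_max f0.
  by case: (is_Cc_max Cf Cg).
- move=> f g [Cf f0] [Cg g0]; split=> [|x]; last by rewrite le_min f0 g0.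
  by case: (is_Cc_min Cf Cg).
Qed.

(* The countable sup property extracts a sequence from the directed family
   [F]; it is made monotone by taking finite suprema (resp. infima).  It is
   enough to test against [v >= 0], because monotone completeness provides an
   infimum in all of [E] for the integrals of a decreasing family. *)
Lemma directed_mlim d P (F : set (X -> R)) f : cone_lattice mu P -> F `<=` P ->
  F !=set0 -> (forall g h, F g -> F h -> F (fun x => mjoin d (g x) (h x))) ->
  L1p f -> (forall g x, F g -> mle d (g x) (f x)) ->
  (forall v, 0 <= v -> (forall g, F g -> if d then I g <= v else v <= I g) ->
     if d then I f <= v else v <= I f) ->
  mlim mu d P f.
Proof.
move=> cP FP [f0 Ff0] Fjoin Lf Ff ext.
have [PL _ _ _ _] := cP; have FL g (Fg : F g) : L1p g := PL _ (FP _ Fg).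
pose J := {g : X -> R | F g}; pose u (j : J) := I (sval j).
pose leJ (i j : J) := forall x, mle d (sval i x) (sval j x).
have dirJ : directed leJ.
  split; first by constructor; exists f0.
  - by move=> i x; exact: mle_refl.
  - by move=> i j k ij jk x; exact: mle_trans (ij x) (jk x).
  - move=> [g Fg] [h Fh]; exists (exist _ _ (Fjoin _ _ Fg Fh)).
    by split=> x; [exact: mle_joinl|exact: mle_joinr].
have joinsF (l : nat -> J) n : F (fun x => mjoins d (fun i => sval (l i) x) n).
  elim: n => [|n IH] /=; first exact: svalP.
  by apply: Fjoin => //; exact: svalP.
have joins_le (l : nat -> J) n x : mle d (mjoins d (fun i => sval (l i) x) n) (f x).
  by apply: mjoins_lub => i _; apply: Ff; exact: svalP.
have joins_nd (l : nat -> J) x m n : (m <= n)%N ->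
    mle d (mjoins d (fun i => sval (l i) x) m) (mjoins d (fun i => sval (l i) x) n).
  exact: mjoins_mono.
case: d => [|] in Ff Fjoin leJ dirJ ext joinsF joins_le joins_nd *.
  have incu : increasing_net leJ u.
    by split=> // i j ij; apply: Imu_le => //; apply: FL; exact: svalP.
  have uf : supremums (range u) (I f).
    apply/supremums_rangeP; split=> [[g Fg]|v uv].
      by apply: Imu_le => //; [exact: FL|move=> x; exact: Ff].
    (* [v] is above the integral of [f0], hence positive. *)
    apply: ext => [|g Fg]; last exact: (uv (exist _ g Fg)).
    apply: le_trans (uv (exist _ f0 Ff0)); exact: Imu_ge0 (FL _ Ff0).
  have [l lsup] := countable_sup_propertyT cspE incu uf.
  apply/(mlim_upP mcE _ PL); split=> //.
  exists (fun n x => mjoins true (fun i => sval (l i) x) n); split.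
  - by move=> n; apply: FP; exact: joinsF.
  - by move=> x m n; exact: joins_nd.
  - by move=> n x; exact: (joins_le l n x).
  - have [_ lb] := (supremums_rangeP _ _).1 lsup.
    apply/supremums_rangeP; split=> [n|y uy].
      by apply: Imu_le => //; [exact: FL (joinsF l n)|exact: (joins_le l n)].
    apply: lb => n; apply: le_trans (uy n); apply: Imu_le => //.
    + by apply: FL; exact: svalP.
    + exact: FL (joinsF l n).
    + by move=> x; exact: (mjoins_ub true (fun i => sval (l i) x) (leqnn n)).
have decu : decreasing_net leJ u.
  by split=> // i j ij; apply: Imu_le => //; apply: FL; exact: svalP.
have f_le g : F g -> I f <= I g.
  by move=> Fg; apply: Imu_le => //; [exact: FL|move=> x; exact: Ff].
have uf : infimums (range u) (I f).
  (* Monotone completeness gives the integrals an infimum [0 - s], and this is at least [I f]. It is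
     therefore positive, and [ext] applies with [v = 0 - s]. *)
  have [||s us] := mcE (leI := leJ) (u := fun j => 0 - u j).
  - by split=> // i j ij; rewrite povs_leD2lE povs_leN; exact: (decu.2 _ _ ij).
  - exists (0 - I f) => _ [[g Fg] _ <-].
    by rewrite povs_leD2lE povs_leN; exact: f_le.
  have := infimums_range_sub 0 us.
  have -> : (fun j => 0 - (0 - u j)) = u by apply/funext => j; rewrite subKr.
  move=> uinf; suff <- : 0 - s = I f by [].
  have [lb ub] := (infimums_rangeP _ _).1 uinf.
  have fs : I f <= 0 - s by apply: ub => -[g Fg]; exact: f_le.
  apply/eqP; rewrite eq_le fs andbT; apply: ext => [|g Fg].
    by apply: le_trans fs; exact: Imu_ge0.
  exact: (lb (exist _ g Fg)).
have [l linf] := countable_inf_property cspE decu uf.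
apply/(mlim_downP mcE _ PL); split=> //.
exists (fun n x => mjoins false (fun i => sval (l i) x) n); split.
- by move=> n; apply: FP; exact: joinsF.
- by move=> x m n; exact: joins_nd.
- by move=> n x; exact: (joins_le l n x).
- have [_ lb] := (infimums_rangeP _ _).1 linf.
  apply/infimums_rangeP; split=> [n|y uy].
    by apply: Imu_le => //; [exact: FL (joinsF l n)|exact: (joins_le l n)].
  apply: lb => n; apply: le_trans (uy n) _; apply: Imu_le => //.
  + exact: FL (joinsF l n).
  + by apply: FL; exact: svalP.
  + by move=> x; exact: (mjoins_ub false (fun i => sval (l i) x) (leqnn n)).
Qed.

Lemma indic_le (A B : set X) x : A `<=` B -> \1_A x <= \1_B x :> R.
Proof.
move=> AB; rewrite !indicE; have [/set_mem/AB/mem_set ->//|_] := boolP (x \in A).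
by case: (_ \in _).
Qed.

Lemma max_indic (A B : set X) :
  (fun x => Num.max (\1_A x) (\1_B x)) = \1_(A `|` B) :> (X -> R).
Proof.
apply/funext => x; rewrite !indicE in_setU.
by case: (x \in A); case: (x \in B); rewrite /= /Num.max ?ltxx ?ltr01 ?ltr10.
Qed.

Lemma min_indic (A B : set X) :
  (fun x => Num.min (\1_A x) (\1_B x)) = \1_(A `&` B) :> (X -> R).
Proof.
apply/funext => x; rewrite !indicE in_setI.
by case: (x \in A); case: (x \in B); rewrite /= /Num.min ?ltxx ?ltr01 ?ltr10.
Qed.

(** [mu_open] gives the supremum only among positive elements, which is what [directed_mlim] tests;
    the family is directed since a maximum of functions supported in [V] is supported in [V]. *)
Lemma open_indic_mlim V v : open V -> mu V = Fin v -> mlim mu true C0 \1_V.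
Proof.
move=> oV muV; have [LV IV] := L1p_indic mcE (borel_open oV) muV.
have [[v0 ubv] lbv] := mu_open oV muV.
pose F : set (X -> R) := [set f | is_Cc f /\ (forall x, 0 <= f x <= 1) /\ supp f `<=` V].
have FE : I @` F = [set pi f | f in [set f | prec_open f V]].
  apply/seteqP; split=> _ [f Vf <-].
    have [Cf fV] := Vf; have pf : f \in Cc_pred by apply/asboolP.
    by exists (CcType pf) => //; rewrite (pi_int _).2.
  by exists f; [split=> //; exact: Cc_is_Cc|rewrite (pi_int _).2].
have F0 : F (fun _ => 0).
  by split; [exact: is_Cc0|split=> [x|]; rewrite ?lexx ?ler01// supp0].
apply: (directed_mlim Ccp_cone_lattice (F := F)) => //.
- by move=> f [Cf [f01 _]]; split=> // x; case/andP: (f01 x).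
- by exists (fun _ => 0).
- move=> f g [Cf [f01 Vf]] [Cg [g01 Vg]]; have [Cm sm] := is_Cc_max Cf Cg.
  split=> //; split=> [x|]; last by move=> x /sm[/Vf|/Vg].
  by have /andP[f0 f1] := f01 x; have /andP[g0 g1] := g01 x;
    rewrite /= le_max ge_max f0 f1 g1.
- move=> f x [_ [f01 Vf]]; have /andP[f0 f1] := f01 x; rewrite /= indicE.
  have [//|/negP xV] := boolP (x \in V); rewrite notin_supp// => /Vf.
  by move/mem_set.
- move=> y y0 yub; rewrite IV; apply: lbv; split=> //.
  by rewrite -FE => _ [g Fg <-]; exact: yub.
Qed.

Lemma compact_borel K : compact K -> borel X K.
Proof. by move=> kK; apply: borel_closed; exact: compact_closed. Qed.

(** The assumed [f] with [prec_compact K f] makes the directed family non-empty. *)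
Lemma compact_indic_mlim K : compact K ->
  (exists f : Cc R X, prec_compact K f) -> mlim mu false C0 \1_K.
Proof.
move=> kK [f0 Kf0]; have [bmu _ _] := mu_reg; have [k muK] := bmu K kK.
have [LK IK] := L1p_indic mcE (compact_borel kK) muK.
have [[k0 lbk] ubk] := mu_compact kK muK.
pose F : set (X -> R) :=
  [set f | is_Cc f /\ (forall x, 0 <= f x <= 1) /\ (forall x, K x -> f x = 1)].
have FE : I @` F = [set pi f | f in [set f | prec_compact K f]].
  apply/seteqP; split=> _ [f Vf <-].
    have [Cf fV] := Vf; have pf : f \in Cc_pred by apply/asboolP.
    by exists (CcType pf) => //; rewrite (pi_int _).2.
  by exists f; [split=> //; exact: Cc_is_Cc|rewrite (pi_int _).2].
apply: (directed_mlim Ccp_cone_lattice (F := F)) => //.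
- by move=> f [Cf [f01 _]]; split=> // x; case/andP: (f01 x).
- by exists f0; split=> //; exact: Cc_is_Cc.
- move=> f g [Cf [f01 Kf]] [Cg [g01 Kg]]; have [Cm _] := is_Cc_min Cf Cg.
  split=> //; split=> [x|x Kx] /=; last by rewrite Kf// Kg// minxx.
  by have /andP[f0' f1] := f01 x; have /andP[g0 g1] := g01 x;
    rewrite /= le_min ge_min f0' g0 f1.
- move=> f x [_ [f01 Kf]]; have /andP[f0' f1] := f01 x; rewrite /= indicE.
  by have [/set_mem/Kf ->|] := boolP (x \in K).
- move=> y y0 ylb; rewrite IK; apply: ubk; split=> //.
  by rewrite -FE => _ [g Fg <-]; exact: ylb.
Qed.

Lemma Borel_indic_mlim_open A v : borel X A -> mu A = Fin v ->
  mlim mu false (mlim mu true C0) \1_A.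
Proof.
move=> mA muA; have [LA IA] := L1p_indic mcE mA muA.
have [_ _ /(_ A mA)] := mu_reg; rewrite /outer_regular_at muA => -[lbA ubA].
pose F : set (X -> R) := [set \1_V | V in [set V | [/\ open V, A `<=` V & efinite (mu V)]]].
have IF V w : open V -> mu V = Fin w -> I \1_V = w.
  by move=> oV Vw; case: (L1p_indic mcE (borel_open oV) Vw).
have C1 : cone_lattice mu (mlim mu true C0).
  exact: mlim_cone_lattice Ccp_cone_lattice.
apply: (directed_mlim C1 (F := F)) => //.
- by move=> _ [V [oV AV [w Vw]] <-]; exact: open_indic_mlim Vw.
(* Were all open sets containing [A] of infinite measure, [Infty] would be a lower bound of their
   measures, hence below [Fin v]. *)
- apply: contrapT => nF; suff : Infty <= Fin v by [].
  apply: ubA => _ [V [oV AV] <-]; case muV: (mu V) => [w|]; last exact: le_Infty.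
  by case: nF; exists \1_V, V => //; split=> //; exists w.
- move=> _ _ [V [oV AV [w Vw]] <-] [W [oW AW _] <-]; exists (V `&` W).
    split; [exact: openI|by rewrite subsetI|].
    have [u -> _] := measure_finite (borel_open (openI oV oW)) (borel_open oV)
      (@subIsetl _ _ _) Vw.
    by exists u.
  by rewrite -min_indic.
- by move=> _ x [V [oV AV _] <-]; exact: indic_le.
- move=> y y0 ylb; rewrite IA -Fin_le; apply: ubA => _ [V [oV AV] <-].
  case muV: (mu V) => [w|]; last exact: le_Infty.
  rewrite Fin_le -(IF _ _ oV muV); apply: ylb; exists V => //; split=> //.
  by exists w.
Qed.

Lemma Borel_indic_mlim_compact A v : borel X A -> mu A = Fin v ->
  inner_regular_at mu A ->
  (forall K, compact K -> exists f : Cc R X, prec_compact K f) ->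
  mlim mu true (mlim mu false C0) \1_A.
Proof.
move=> mA muA; rewrite /inner_regular_at muA => -[ubA lbA] urysohn_K.
have [LA IA] := L1p_indic mcE mA muA; have [bmu _ _] := mu_reg.
pose F : set (X -> R) := [set \1_K | K in [set K | compact K /\ K `<=` A]].
have D1 : cone_lattice mu (mlim mu false C0).
  exact: mlim_cone_lattice Ccp_cone_lattice.
apply: (directed_mlim D1 (F := F)) => //.
- by move=> _ [K [kK KA] <-]; apply: compact_indic_mlim => //; exact: urysohn_K.
- by exists \1_set0, set0 => //; split=> //; exact: compact0.
- move=> _ _ [K [kK KA] <-] [L [kL LA'] <-]; exists (K `|` L).
    by split; [exact: compactU|rewrite subUset].
  by rewrite -max_indic.
- by move=> _ x [K [kK KA] <-]; exact: indic_le.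
- move=> y y0 yub; rewrite IA -Fin_le; apply: lbA => _ [K [kK KA] <-].
  have [w muK] := bmu K kK; rewrite muK Fin_le.
  have [_ <-] := L1p_indic mcE (compact_borel kK) muK.
  by apply: yub; exists K.
Qed.

(** A fibre with [h t = 0] may have infinite measure but contributes nothing; if [h t > 0],
    integrability and Markov's inequality make its measure finite, so its indicator is in [P]. *)
Lemma simple_in_cone P : cone_lattice mu P ->
  (forall A v, borel X A -> mu A = Fin v -> P \1_A) ->
  forall f, simple_nonneg f -> L1p f -> P f.
Proof.
move=> [PL PD PZ _ _] Pind f sf Lf; have [T [p [h [fE h0 mp]]]] := simple_fibersP sf.
have P0 : P (fun _ => 0).
  have := Pind set0 0 (@borel_set0 X) (measure_fun0 mu).
  by congr P; apply/funext => x; rewrite indicE in_set0.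
have term t : P (fun x => h t * \1_(p @^-1` [set t]) x).
  have [ht0|htn0] := eqVneq (h t) 0.
    by move: P0; congr P; apply/funext => x; rewrite ht0 mul0r.
  have ht : 0 < h t by rewrite lt0r htn0 h0.
  have ht_le x : (p @^-1` [set t]) x -> h t <= f x by rewrite fE /= => ->.
  have := order_integral_markov mu mcE (L1p_measurable Lf) (L1p_ge0 Lf) (mp t)
    (h0 t) ht_le.
  rewrite (order_integral_Imu mcE Lf); case muA: (mu (p @^-1` [set t])) => [v|].
    by move=> _; apply: PZ => //; exact: Pind muA.
  by rewrite /= (negbTE htn0).
have sum_t (s : seq T) : P (fun x => \sum_(t <- s) h t * \1_(p @^-1` [set t]) x).
  elim: s => [|t s IH].
    by move: P0; congr P; apply/funext => x; rewrite big_nil.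
  have := PD _ _ (term t) IH; congr P; apply/funext => x; rewrite big_cons.
  by [].
move: (sum_t (index_enum T)); congr P; apply/funext => x.
rewrite (bigD1 (p x))//= indicE mem_set// mulr1 big1 ?addr0 ?fE// => t tpx.
rewrite indicE memNset ?mulr0// => /= pxt.
by rewrite pxt eqxx in tpx.
Qed.

Lemma L1p_mlim_open : L1p `<=` mlim mu true (mlim mu false (mlim mu true C0)).
Proof.
move=> f Lf; have C1 := mlim_cone_lattice mcE true Ccp_cone_lattice.
have C2 := mlim_cone_lattice mcE false C1.
have [phi [sphi Lphi ndphi phif supphi]] := L1p_approx mcE Lf.
apply/(mlim_upP mcE); first exact: mlim_L1p.
split=> //; exists phi; split=> // n; apply: (simple_in_cone C2) => //.
by move=> A v; exact: Borel_indic_mlim_open.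
Qed.

Lemma L1p_mlim_compact :
  (forall A, borel X A -> efinite (mu A) -> inner_regular_at mu A) ->
  (forall K, compact K -> exists f : Cc R X, prec_compact K f) ->
  L1p `<=` mlim mu true (mlim mu false C0).
Proof.
move=> inreg urysohn_K f Lf.
have D1 := mlim_cone_lattice mcE false Ccp_cone_lattice.
have D2 := mlim_cone_lattice mcE true D1.
have [phi [sphi Lphi ndphi phif supphi]] := L1p_approx mcE Lf.
apply: (mlim_idem mcE D1); apply/(mlim_upP mcE); first exact: mlim_L1p.
split=> //; exists phi; split=> // n; apply: (simple_in_cone D2) => //.
move=> A v mA muA; apply: (Borel_indic_mlim_compact mA muA) => //.
by apply: inreg => //; exists v.
Qed.

Lemma bounded_mlim f (M : R) : finite_measure mu -> L1p f ->
  (forall x, f x <= M) -> mlim mu false (mlim mu true C0) f.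
Proof.
move=> [m muX] Lf fM; have C1 := mlim_cone_lattice mcE true Ccp_cone_lattice.
have C2 := mlim_cone_lattice mcE false C1.
(* Only on the empty space can [M] be negative; its positive part covers that case too. *)
have [c0 fc] : 0 <= Num.max M 0 /\ forall x, f x <= Num.max M 0.
  by rewrite le_max lexx orbT; split=> // x; rewrite le_max fM.
move: (Num.max M 0) c0 fc => c c0 fc.
have Lc : L1p (fun _ => c).
  have [L1 _] := L1p_indic mcE (@borelT X) muX.
  have := L1pZ mcE c0 L1; congr L1p; apply/funext => x.
  by rewrite indicE in_setT mulr1.
(* Simple functions [phi n] approximating [c - f] from below give simple functions [c - phi n]
   approximating [f] from above. *)
have Lg := L1pB mcE Lc Lf fc.
have [phi [sphi Lphi ndphi phig supphi]] := L1p_approx mcE Lg.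
have phic n x : phi n x <= c.
  by apply: le_trans (phig n x) _; rewrite gerBl (L1p_ge0 Lf).
have Lpsi n : L1p (fun x => c - phi n x) by exact: L1pB.
have Ipsi n : I (fun x => c - phi n x) = I (fun _ => c) - I (phi n) by exact: ImuB.
apply: (mlim_idem mcE C1); apply/(mlim_downP mcE); first exact: mlim_L1p.
split=> //; exists (fun n x => c - phi n x); split.
- move=> n; apply: (simple_in_cone C2) => //.
    by move=> A v; exact: Borel_indic_mlim_open.
  have [mphi fphi _] := sphi n; have [mc fcst _] := @simple_cst R X c c0.
  split; [exact: borel_measurableB| |by move=> x; rewrite subr_ge0].
  exact: (finite_range_op (fun a b => a - b)).
- by move=> x i j ij; rewrite lerD2l lerN2; exact: ndphi.
- by move=> n x; rewrite lerBrDl -lerBrDr; exact: phig.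
- have := infimums_range_sub (I (fun _ => c)) supphi.
  have -> : I (fun _ => c) - I (fun x => c - f x) = I f by rewrite ImuB// subKr.
  suff <- : (fun n => I (fun x => c - phi n x)) = (fun n => I (fun _ => c) - I (phi n)) by [].
  exact/funext.
Qed.

(* This replaces Urysohn's lemma: without any [f] with [prec_compact K f], the
   infimum hypothesis makes [mu K] the largest element of the positive cone. *)
Lemma prec_compact_or_trivial :
  (forall K, compact K -> exists f : Cc R X, prec_compact K f) \/
  (forall e : E, 0 <= e -> e = 0).
Proof.
have [H|/existsNP[K /not_implyP[kK nf]]] :=
  pselect (forall K, compact K -> exists f : Cc R X, prec_compact K f); first by left.
right=> e e0; have [bmu _ _] := mu_reg; have [k muK] := bmu K kK.
have [[k0 _] ubk] := mu_compact kK muK.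
apply/eqP; rewrite eq_le e0 andbT.
have := ubk (k + e); rewrite -[X in _ <= X](addr0 k) povs_leD2lE; apply.
split; first exact: povs_addr_ge0.
by move=> _ [f Kf <-]; case: nf; exists f.
Qed.

End approximation.

(** * The closures in [E] and in [L1] *)

Section main.
Context {R : realType} {E : povsType R} {X : topologicalType}.
Variable mu : borel_set_measure E X.
Hypothesis mcE : monotone_complete E.
Local Notation L1p := (ointegrable_nonneg mu).
Local Notation I := (Imu mu).
Local Notation C0 := (Ccp R X).
Local Open Scope quotient_scope.

Lemma IL1_aeclasses (P : set (X -> R)) : P `<=` L1p ->
  I @` P `<=` IL1 mu @` aeclasses mu P.
Proof.
move=> PL _ [f Pf <-]; have [g gE] := bmfunP (L1p_measurable (PL _ Pf)).
exists (\pi_(L0 mu) g); first by exists g => //=; rewrite gE.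
by rewrite IL1_class// gE//; exact: PL.
Qed.

(** [L0] carries an order but no addition here, so positivity is expressed by comparison with this
    class. *)
Definition zero_class : L0 mu :=
  \pi_(L0 mu) (Bmfun (asboolT (@borel_measurable_cst R X 0))).

Lemma L1_zero_class : L1 mu zero_class.
Proof.
exists (Bmfun (asboolT (@borel_measurable_cst R X 0))) => //=.
by case: (L1p0 mu mcE).
Qed.

Lemma IL1_above_zero (S : set (L0 mu)) :
  S `<=` [set q | L1 mu q /\ (zero_class <= q)%O] -> IL1 mu @` S `<=` I @` L1p.
Proof. by move=> Sz _ [q /Sz[Lq zq] <-]; exact: IL1_nonneg zq. Qed.

Lemma aeclasses_above_zero (P : set (X -> R)) : P `<=` L1p ->
  aeclasses mu P `<=` [set q | L1 mu q /\ (zero_class <= q)%O].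
Proof.
move=> PL _ [f Pf <-]; have Lf := PL _ Pf; split; first by exists f => //; exact: Lf.1.
by apply/L0_leP/aeT => x; exact: (L1p_ge0 Lf).
Qed.

End main.

Theorem theorem5p9 (R : realType) (X : topologicalType) (E : povsType R)
    (pi : {linear Cc R X -> E}) (mu : borel_set_measure E X)
    (hausX : hausdorff_space X) (lcX : locally_compact [set: X])
    (mcE : monotone_complete E) (pi_pos : positive_operator pi)
    (mu_reg : regular_borel_measure mu)
    (pi_int : forall f : Cc R X, ointegrable mu f /\ pi f = Imu mu f)
    (mu_open : forall (V : set X) (v : E), open V -> mu V = Fin v ->
       supremums_in (poscone E) [set pi f | f in [set f | prec_open f V]] v)
    (mu_compact : forall (K : set X) (k : E), compact K -> mu K = Fin k ->
       infimums_in (poscone E) [set pi f | f in [set f | prec_compact K f]] k)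
    (cspE : countable_sup_property E)
    (Imu_mod : preserves_moduli_on (ointegrable mu) (Imu mu)) :
  let I_L1pos : set E := Imu mu @` ointegrable_nonneg mu in
  let Cc_pos : set (L0 mu) :=
    aeclasses mu [set (f : X -> R) | f in Cc_nonneg R X] in
  let piCc_pos : set E := pi @` Cc_nonneg R X in
  [/\
      [/\ I_L1pos = net_up I_L1pos,
          I_L1pos = net_down I_L1pos,
          I_L1pos = IL1 mu @`
            seq_up_in (L1 mu) (seq_down_in (L1 mu) (seq_up_in (L1 mu) Cc_pos)) &
          I_L1pos = seq_up (seq_down (seq_up piCc_pos))],
      (forall A, borel X A -> efinite (mu A) -> inner_regular_at mu A) ->
      I_L1pos = IL1 mu @`
        seq_up_in (L1 mu) (seq_down_in (L1 mu) Cc_pos) /\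
      I_L1pos = seq_up (seq_down piCc_pos) &
      finite_measure mu -> L1 mu = Bdd mu ->
      I_L1pos = IL1 mu @`
        seq_down_in (L1 mu) (seq_up_in (L1 mu) Cc_pos) /\
      I_L1pos = seq_down (seq_up piCc_pos)].
Proof.
move=> I_L1pos Cc_pos piCc_pos.
have piE : piCc_pos = Imu mu @` Ccp R X by exact: (pi_Ccp pi_int).
have C0L : Ccp R X `<=` ointegrable_nonneg mu := Ccp_L1p pi_int.
have CcE : Cc_pos = aeclasses mu (Ccp R X) by rewrite /Cc_pos CcpE.
have L1z := L1_zero_class mu mcE.
have upL1 (S : set E) : S `<=` I_L1pos -> seq_up S `<=` I_L1pos.
  exact: seq_up_Imu_L1p.
have downL1 (S : set E) : S `<=` I_L1pos -> seq_down S `<=` I_L1pos.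
  exact: seq_down_Imu_L1p.
have C0I : Imu mu @` Ccp R X `<=` I_L1pos by move=> _ [f Cf <-]; exists f => //; exact: C0L.
have C0z := aeclasses_above_zero C0L.
have mL d P : mlim mu d P `<=` ointegrable_nonneg mu := @mlim_L1p _ _ _ mu d P.
have upc P S : P `<=` ointegrable_nonneg mu -> aeclasses mu P `<=` S ->
    aeclasses mu (mlim mu true P) `<=` seq_up_in (L1 mu) S.
  by move=> PL PS q /(aeclasses_mlim_up mcE PL); exact: seq_up_in_sub.
have downc P S : P `<=` ointegrable_nonneg mu -> aeclasses mu P `<=` S ->
    aeclasses mu (mlim mu false P) `<=` seq_down_in (L1 mu) S.
  by move=> PL PS q /(aeclasses_mlim_down mcE PL); exact: seq_down_in_sub.
have upI P (S : set E) : P `<=` ointegrable_nonneg mu -> Imu mu @` P `<=` S ->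
    Imu mu @` mlim mu true P `<=` seq_up S.
  by move=> PL PS q /(Imu_mlim_up mcE PL); exact: seq_up_in_sub.
have downI P (S : set E) : P `<=` ointegrable_nonneg mu -> Imu mu @` P `<=` S ->
    Imu mu @` mlim mu false P `<=` seq_down S.
  by move=> PL PS q /(Imu_mlim_down mcE PL); exact: seq_down_in_sub.
(* Both closures lie between the integrals of the function-level limits and all
   of [I_L1pos]. *)
have conclude P S (S' : set E) : P `<=` ointegrable_nonneg mu -> I_L1pos `<=` Imu mu @` P ->
    aeclasses mu P `<=` S -> S `<=` [set q | L1 mu q /\ (zero_class mu <= q)%O] ->
    Imu mu @` P `<=` S' -> S' `<=` I_L1pos ->
    I_L1pos = IL1 mu @` S /\ I_L1pos = S'.
  move=> PL LP PS Sz PS' S'L; split; apply/seteqP; split; last exact: S'L.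
  - by move=> v /LP/(IL1_aeclasses mcE PL)[q Pq <-]; exists q => //; exact: PS.
  - exact: IL1_above_zero.
  - by move=> v /LP; exact: PS'.
rewrite CcE piE; split.
- have [|||||e1 e2] := conclude (mlim mu true (mlim mu false (mlim mu true (Ccp R X))))
    (seq_up_in (L1 mu) (seq_down_in (L1 mu) (seq_up_in (L1 mu) (aeclasses mu (Ccp R X)))))
    (seq_up (seq_down (seq_up (Imu mu @` Ccp R X)))) (mL _ _).
  + by move=> _ [f Lf <-]; exists f => //; exact: (L1p_mlim_open (pi := pi)).
  + by apply: (upc _) => //; apply: (downc _) => //; exact: upc.
  + by apply: seq_up_in_bounded; apply: seq_down_in_bounded => //; exact: seq_up_in_bounded.
  + by apply: (upI _) => //; apply: (downI _) => //; exact: upI.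
  + by apply: (upL1 _); apply: (downL1 _); exact: upL1.
  by split=> //; rewrite /I_L1pos ?net_up_Imu_L1p ?net_down_Imu_L1p.
- move=> inreg; apply: (conclude (mlim mu true (mlim mu false (Ccp R X)))) => //.
  + have [urysohn_K|E0] := prec_compact_or_trivial mu_reg mu_compact.
      by move=> _ [f Lf <-]; exists f => //; exact: (L1p_mlim_compact (pi := pi)).
    (* [E] is trivial here, so all integrals are [0] and the zero function represents them. *)
    move=> _ [f Lf <-]; exists (fun _ => 0).
      by apply: sub_mlim => //; apply: sub_mlim => //; split=> //; exact: is_Cc0.
    by rewrite Imu0//; apply/esym/E0; exact: Imu_ge0.
  + by apply: (upc _) => //; exact: downc.
  + by apply: seq_up_in_bounded; exact: seq_down_in_bounded.
  + by apply: (upI _) => //; exact: downI.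
  + by apply: (upL1 _); exact: downL1.
- move=> finmu L1B; apply: (conclude (mlim mu false (mlim mu true (Ccp R X)))) => //.
  + move=> _ [f Lf <-]; have [g gE] := bmfunP (L1p_measurable Lf).
    have : L1 mu (\pi_(L0 mu)%qT g) by exists g => //=; rewrite gE; exact: Lf.1.
    (* The class of [f] has a bounded member [h], whose absolute value is bounded, positive
       everywhere and almost everywhere equal to [f]. *)
    rewrite L1B => -[h [M hM] /eqmodP/asboolP hg].
    have mh := borel_measurable_norm (bmfun_measurable h).
    have fh : oae mu (fun x => f x = `|h x|).
      by apply: (aeI _ hg hg) => x -> _; rewrite gE ger0_norm// (L1p_ge0 Lf).
    have [Lh <-] := Imu_ae mcE Lf mh (fun x => normr_ge0 _) fh.
    by exists (fun x => `|h x|) => //; exact: (bounded_mlim (pi := pi)) hM.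
  + by apply: (downc _) => //; exact: upc.
  + by apply: seq_down_in_bounded => //; exact: seq_up_in_bounded.
  + by apply: (downI _) => //; exact: upI.
  + by apply: (downL1 _); exact: upL1.
Qed.
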